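(* Let $qF$ be the quasi-$F$ covering operator and $\mu(qF)$ the associated hull operator on $\mathbf{W}^*$. (i) $\mathcal{V}(C(\beta\mathbb{N}),\mu(qF))$ has minimum $F(\alpha\mathbb{N})$. (ii) $\mathcal{V}(C(K),\mu(qF))$ has no minimum if $K$ is a connected compact Hausdorff almost-$P$ space. (iii) $\mathcal{V}(C(K),\mu(qF))$ has minimum $F(K)$ if $K$ is a zero-dimensional compact Hausdorff almost-$P$ space.
   Context: For compact Hausdorff $X,Z$, a continuous surjection $f:Z\to X$ is a covering map if $f(F)\neq X$ for every proper closed $F\subset Z$; then $(Z,f)$ is a cover of $X$. For covers of $X$, $(Z_1,f_1)\le(Z_2,f_2)$ iff there is a continuous $f:Z_2\to Z_1$ with $f_2=f_1\circ f$; covers $\le$ each other are identified, giving $\operatorname{cov}X$. A space is quasi-$F$ if each of its dense cozero-sets is $C^*$-embedded (every bounded continuous real-valued function on it extends continuously to the space). $qF$ assigns to each compact Hausdorff $X$ the minimum $(qFX,qF_X)$ in $\{(Z,f)\in\operatorname{cov}X:Z\text{ quasi-}F\}$ (it exists). A space is almost-$P$ if it has no proper dense cozero-set. $\alpha\mathbb{N}$ and $\beta\mathbb{N}$ are the one-point and the Čech–Stone compactifications of the discrete space $\mathbb{N}$. $\mathbf{W}^*$ is the category of Archimedean vector lattices with distinguished strong unit and unit-preserving vector lattice homomorphisms. For compact Hausdorff $X$, $C(X)\in\mathbf{W}^*$ is the vector lattice of continuous real-valued functions on $X$ with unit the constant function $1$; $F(X)=\{f\in C(X): f(X)\text{ is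 finite}\}$. An injective morphism $f:A\to B$ is essential if for every $0<b\in B$ there are $0<a\in A$ and $n\in\mathbb{N}$ with $f(a)\le nb$; then $(B,f)$ is an essential extension of $A$; for essential extensions of $A$, $(B_1,f_1)\le(B_2,f_2)$ iff there is a morphism $f:B_1\to B_2$ with $f_2=f\circ f_1$, and extensions $\le$ each other are identified, giving $\operatorname{ext}A$. A hull operator $h$ on $\mathbf{W}^*$ assigns to each $A$ some $(hA,h_A)\in\operatorname{ext}A$ that is the minimum in $\{(B,f)\in\operatorname{ext}A: h_B\text{ is an isomorphism}\}$. For $A\in\mathbf{W}^*$ with unit $u$, the Yosida space $YA$ is the compact Hausdorff space of ideals of $A$ maximal with respect to not containing $u$, with the hull-kernel topology; there is an injective morphism $\nu_A:A\to C(YA)$ whose image separates points, and $(YA,\nu_A)$ is unique up to homeomorphism with this property. $\mu(qF)$ is the hull operator given by $\mu(qF)A=C(qFYA)$ with essential embedding $\mu(qF)_A(a)=\nu_A(a)\circ qF_{YA}$. For $H\in\mathbf{W}^*$ with $\mu(qF)H=H$ (i.e. $\mu(qF)_H$ is an isomorphism), $\mathcal{V}(H,\mu(qF))=\{A\in\mathbf{W}^*:\mu(qF)A=H\}$, where $A$ is identified with the pair $(A,\mu(qF)_A)$; i.e. the elements are pairs $(A,f)$, $f:A\to H$ an essential embedding with $(H,f)=(\mu(qF)A,\mu(qF)_A)$ in $\operatorname{ext}A$. Order: $(A_1,f_1)\le(A_2,f_2)$ iff there is an essential embedding $f:A_1\to A_2$ with $f_1=f_2\circ f$; pairs $\le$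 each other are identified.
   Formalization: In (ii), K is additionally assumed to have at least two points; for a one-point K (connected, compact Hausdorff, almost-P) C(K) is the reals and V(C(K), μ(qF)) consists of C(K) alone, so it does have a minimum. *)

(* Defs.v *)
From HB Require Import structures.
From mathcomp Require Import all_boot all_order all_algebra.
From mathcomp Require Import all_classical all_reals all_analysis.

Set Implicit Arguments.
Unset Strict Implicit.
Unset Printing Implicit Defensive.

Import Order.TTheory GRing.Theory Num.Theory.
Import numFieldNormedType.Exports.

Local Open Scope classical_set_scope.
Local Open Scope ring_scope.

(* The order is a field of its own instead of an [Order.lattice] structure:
   MathComp has no structure joining [GRing.Zmodule] and [Order.Lattice] below
   the (totally ordered) [Num.RealDomain], so the two cannot be combined. *)
HB.mixin Record Lmodule_isVectorLattice (R : realType) A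
    of GRing.Lmodule R A := {
  vle : A -> A -> Prop;
  vmeet : A -> A -> A;
  vjoin : A -> A -> A;
  vle_refl : forall x, vle x x;
  vle_anti : forall x y, vle x y -> vle y x -> x = y;
  vle_trans : forall y x z, vle x y -> vle y z -> vle x z;
  vle_meetl : forall x y, vle (vmeet x y) x;
  vle_meetr : forall x y, vle (vmeet x y) y;
  vle_meet : forall x y z, vle z x -> vle z y -> vle z (vmeet x y);
  vle_joinl : forall x y, vle x (vjoin x y);
  vle_joinr : forall x y, vle y (vjoin x y);
  vle_join : forall x y z, vle x z -> vle y z -> vle (vjoin x y) z;
  vle_D2r : forall z x y, vle x y -> vle (x + z) (y + z);
  vle_scale : forall (r : R) x, 0 <= r -> vle 0 x -> vle 0 (r *: x)
}.

#[short(type="vectorLatticeType")]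
HB.structure Definition VectorLattice (R : realType) :=
  { A of GRing.Lmodule R A & Lmodule_isVectorLattice R A }.

Arguments vle_trans {R s} [y x z].
Arguments vle_D2r {R s} z [x y].
Arguments vle_scale {R s} [r x].

Declare Scope vlattice_scope.
Delimit Scope vlattice_scope with VL.
Notation "x <= y" := (vle x y) : vlattice_scope.
Notation "x < y" := (vle x y /\ x <> y) : vlattice_scope.

Definition vabs (R : realType) (A : vectorLatticeType R) (x : A) : A :=
  vjoin x (- x).

HB.mixin Record VectorLattice_isWStar (R : realType) A
    of VectorLattice R A := {
  wunit : A;
  wunit_ge0 : (0 <= wunit)%VL;
  wunit_strong : forall x : A, exists n : nat, (vabs x <= wunit *+ n)%VL;
  w_archimedean : forall x y : A,
    (0 <= x)%VL -> (forall n : nat, (x *+ n <= y)%VL) -> x = 0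
}.

#[short(type="wstarType")]
HB.structure Definition WStar (R : realType) :=
  { A of VectorLattice_isWStar R A & VectorLattice R A }.

Arguments wunit {R s}.

Section WStarMorphisms.
Context (R : realType).
Implicit Types A B : wstarType R.

Definition wstar_morphism A B (f : A -> B) : Prop :=
  [/\ linear f,
      {morph f : x y / vmeet x y},
      {morph f : x y / vjoin x y} &
      f wunit = wunit].

Definition essential_embedding A B (f : A -> B) : Prop :=
  [/\ wstar_morphism f, injective f &
      forall b : B, (0 < b)%VL ->
        exists (a : A) (n : nat), (0 < a)%VL /\ (f a <= b *+ n)%VL].

Definition ext_le A B1 B2 (f1 : A -> B1) (f2 : A -> B2) : Prop :=
  exists2 f : B1 -> B2, wstar_morphism f & f2 = f \o f1.

Definition ext_eq A B1 B2 (f1 : A -> B1) (f2 : A -> B2) : Prop :=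
  ext_le f1 f2 /\ ext_le f2 f1.

End WStarMorphisms.

Record unit_sublattice (R : realType) (X : Type) := UnitSublattice {
  usl_set : set (X -> R);
  usl_linear : forall r f g, usl_set f -> usl_set g ->
    usl_set (fun x => r * f x + g x);
  usl_min : forall f g, usl_set f -> usl_set g ->
    usl_set (fun x => Num.min (f x) (g x));
  usl_max : forall f g, usl_set f -> usl_set g ->
    usl_set (fun x => Num.max (f x) (g x));
  usl_one : usl_set (fun=> 1);
  usl_bounded : forall f, usl_set f -> exists M : R, forall x, `|f x| <= M
}.

Section FunWStar.
Context (R : realType) (X : Type) (S : unit_sublattice R X).

Definition usl_pred : {pred X -> R} := [pred f | f \in usl_set S].

Lemma usl_predP f : f \in usl_pred <-> usl_set S f.
Proof. by rewrite !inE. Qed.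

Lemma usl_submod_closed : submod_closed usl_pred.
Proof.
have S0 : usl_set S (fun=> 0).
  rewrite (_ : (fun=> 0) = fun x : X => - 1 * (fun=> 1) x + (fun=> 1) x).
    exact/usl_linear/usl_one/usl_one.
  by apply/funext => x /=; rewrite mulr1 addNr.
split; first exact/usl_predP.
by move=> r f g /usl_predP Sf /usl_predP Sg; apply/usl_predP; exact: usl_linear.
Qed.

HB.instance Definition _ :=
  GRing.isSubmodClosed.Build R (X -> R) usl_pred usl_submod_closed.

Definition fun_wstar := {f : X -> R | f \in usl_pred}.
HB.instance Definition _ := SubChoice.on fun_wstar.
HB.instance Definition _ := [SubChoice_isSubLmodule of fun_wstar by <:].

Definition funW (f : fun_wstar) : X -> R := val f.
Coercion funW : fun_wstar >-> Funclass.

Lemma funWP (f : fun_wstar) : usl_set S f.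
Proof. exact/usl_predP/valP. Qed.

Lemma funW_ext (f g : fun_wstar) : f =1 g -> f = g.
Proof. by move=> fg; apply/val_inj/funext. Qed.

Definition mk_funW (f : X -> R) (Sf : usl_set S f) : fun_wstar :=
  exist _ f (proj2 (usl_predP f) Sf).

Let le (f g : fun_wstar) := forall x, f x <= g x.
Let meet (f g : fun_wstar) := mk_funW (usl_min (funWP f) (funWP g)).
Let join (f g : fun_wstar) := mk_funW (usl_max (funWP f) (funWP g)).

Let fw_le_refl f : le f f. Proof. by move=> x. Qed.
Let fw_le_anti f g : le f g -> le g f -> f = g.
Proof. by move=> fg gf; apply: funW_ext => x; apply/le_anti/andP. Qed.
Let fw_le_trans g f h : le f g -> le g h -> le f h.
Proof. by move=> fg gh x; exact: le_trans (gh x). Qed.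
Let fw_le_meetl f g : le (meet f g) f.
Proof. by move=> x; rewrite /funW /= ge_min lexx. Qed.
Let fw_le_meetr f g : le (meet f g) g.
Proof. by move=> x; rewrite /funW /= ge_min lexx orbT. Qed.
Let fw_le_meet f g h : le h f -> le h g -> le h (meet f g).
Proof. by move=> hf hg x; rewrite {2}/funW /= le_min; apply/andP. Qed.
Let fw_le_joinl f g : le f (join f g).
Proof. by move=> x; rewrite /funW /= le_max lexx. Qed.
Let fw_le_joinr f g : le g (join f g).
Proof. by move=> x; rewrite /funW /= le_max lexx orbT. Qed.
Let fw_le_join f g h : le f h -> le g h -> le (join f g) h.
Proof. by move=> fh gh x; rewrite {1}/funW /= ge_max; apply/andP. Qed.
Let fw_le_D2r h f g : le f g -> le (f + h) (g + h).
Proof. by move=> fg x; rewrite /funW /= lerD2r; exact: fg. Qed.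
Let fw_le_scale (r : R) f : 0 <= r -> le 0 f -> le 0 (r *: f).
Proof. by move=> r0 f0 x; rewrite /funW /=; apply: mulr_ge0 => //; exact: f0. Qed.

HB.instance Definition _ := Lmodule_isVectorLattice.Build R fun_wstar
  fw_le_refl fw_le_anti fw_le_trans fw_le_meetl fw_le_meetr fw_le_meet fw_le_joinl fw_le_joinr fw_le_join
  fw_le_D2r fw_le_scale.

Let one := mk_funW (@usl_one R X S).

Let mulrnE (f : fun_wstar) n x :
  (f *+ n : fun_wstar) x = f x *+ n.
Proof.
elim: n => [|n IH]; first by rewrite !mulr0n.
by rewrite !mulrSr -IH.
Qed.

Let one_ge0 : (0 <= one)%VL.
Proof. by move=> x; rewrite /funW /= ler01. Qed.

Let one_strong (f : fun_wstar) : exists n : nat, (vabs f <= one *+ n)%VL.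
Proof.
have [M fM] := usl_bounded (funWP f); exists (Num.bound `|M|) => x.
rewrite mulrnE; have -> : (vabs f : fun_wstar) x = `|f x| by rewrite /funW /= -maxrN.
rewrite [one x](_ : _ = 1)//; apply: le_trans (fM x) _.
by apply: ltW; apply: le_lt_trans (ler_norm _) _; rewrite archi_boundP.
Qed.

Let fun_archimedean (f g : fun_wstar) :
  (0 <= f)%VL -> (forall n : nat, (f *+ n <= g)%VL) -> f = 0.
Proof.
move=> f0 fg; apply: funW_ext => x; apply/eqP/negPn/negP => fx0.
have fxp : 0 < f x by rewrite lt_neqAle eq_sym fx0; exact: f0.
have := fg (Num.bound `|g x / f x|) x; rewrite mulrnE leNgt => /negP; apply.
rewrite -mulr_natl -ltr_pdivrMr//.
by apply: le_lt_trans (ler_norm _) _; rewrite archi_boundP.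
Qed.

HB.instance Definition _ := VectorLattice_isWStar.Build R fun_wstar
  one_ge0 one_strong fun_archimedean.

End FunWStar.

HB.mixin Record Topological_isCompactHausdorff X of Topological X := {
  compactT : compact [set: X];
  hausdorffT : hausdorff_space X
}.

#[short(type="compHausType")]
HB.structure Definition CompactHausdorff :=
  { X of Topological X & Topological_isCompactHausdorff X }.

Lemma nat_locally_compact : locally_compact [set: nat].
Proof.
move=> n _; rewrite withinET; exists [set n]; first by rewrite nbhs_principalE.
split; first exact: compact_set1.
exact: discrete_closed.
Qed.

HB.instance Definition _ := Topological_isCompactHausdorff.Build
  (one_point_compactification nat) one_point_compactification_compact
  (one_point_compactification_hausdorff nat_locally_compact discrete_hausdorff).

Notation alphaN := (one_point_compactification nat).

Section ContinuousFunctions.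
Context (R : realType) (X : compHausType).
Implicit Types f g : X -> R.

Let linearC (r : R) f g :
  continuous f -> continuous g -> continuous (fun x => r * f x + g x).
Proof.
move=> fc gc x; apply: cvgD; last exact: gc.
by apply: cvgM; [exact: cvg_cst|exact: fc].
Qed.

Let minC f g :
  continuous f -> continuous g -> continuous (fun x => Num.min (f x) (g x)).
Proof. by move=> fc gc x; apply: continuous_min; [exact: fc|exact: gc]. Qed.

Let maxC f g :
  continuous f -> continuous g -> continuous (fun x => Num.max (f x) (g x)).
Proof. by move=> fc gc x; apply: continuous_max; [exact: fc|exact: gc]. Qed.

Let oneC : continuous ((fun=> 1) : X -> R).
Proof. by move=> x; exact: cvg_cst. Qed.

Let boundedC f : continuous f -> exists M : R, forall x, `|f x| <= M.
Proof.
move=> fc.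
have /compact_bounded[M [_ fM]] : compact (f @` [set: X]).
  by apply: continuous_compact compactT; exact: continuous_subspaceT.
exists (M + 1) => x; apply: (fM (M + 1)); first by rewrite ltrDl.
by exists x.
Qed.

Definition usl_C : unit_sublattice R X :=
  @UnitSublattice R X [set f | continuous f] linearC minC maxC oneC boundedC.

Let finite_op2 (h : R -> R -> R) f g : finite_set (range f) ->
  finite_set (range g) -> finite_set (range (fun x => h (f x) (g x))).
Proof.
move=> ff gf; apply: (sub_finite_set _ (finite_image2 h ff gf)).
by move=> _ [x _ <-]; exists (f x); [exists x|exists (g x); first exists x].
Qed.

Let finite_one : finite_set (range ((fun=> 1) : X -> R)).
Proof.
by apply: (sub_finite_set _ (finite_set1 1)) => _ [x _ <-].
Qed.

Definition usl_F : unit_sublattice R X :=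
  @UnitSublattice R X [set f | continuous f /\ finite_set (range f)]
  (fun r f g Sf Sg => conj (@linearC r f g Sf.1 Sg.1)
     (@finite_op2 (fun a b => r * a + b) f g Sf.2 Sg.2))
  (fun f g Sf Sg => conj (minC Sf.1 Sg.1) (@finite_op2 Num.min f g Sf.2 Sg.2))
  (fun f g Sf Sg => conj (maxC Sf.1 Sg.1) (@finite_op2 Num.max f g Sf.2 Sg.2))
  (conj oneC finite_one)
  (fun f Sf => boundedC Sf.1).

Definition F_incl (f : fun_wstar usl_F) : fun_wstar usl_C :=
  @mk_funW R X usl_C f (funWP f).1.

End ContinuousFunctions.

Notation Cfun R X := (fun_wstar (usl_C R X)).
Notation Ffun R X := (fun_wstar (usl_F R X)).

Section Covers.
Context (R : realType).

Definition cozero (X : topologicalType) (U : set X) : Prop :=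
  exists2 h : X -> R, continuous h & U = [set x | h x != 0].

(* A real function on [S] is represented by an arbitrary extension [g] of it
   to [X], whose values outside [S] are irrelevant. *)
Definition Cstar_embedded (X : topologicalType) (S : set X) : Prop :=
  forall g : X -> R, {within S, continuous g} ->
    (exists M : R, forall x, S x -> `|g x| <= M) ->
    exists2 G : X -> R, continuous G & forall x, S x -> G x = g x.

Definition quasiF (X : topologicalType) : Prop :=
  forall U : set X, cozero U -> dense U -> Cstar_embedded U.

Definition almostP (X : topologicalType) : Prop :=
  forall U : set X, cozero U -> dense U -> U = setT.

Definition covering_map (Z X : topologicalType) (f : Z -> X) : Prop :=
  [/\ continuous f, range f = setT &
      forall F : set Z, closed F -> f @` F = setT -> F = setT].

Definition cover_le (X Z1 Z2 : topologicalType)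
    (f1 : Z1 -> X) (f2 : Z2 -> X) : Prop :=
  exists2 f : Z2 -> Z1, continuous f & f2 = f1 \o f.

(* [qFX] is only defined up to equivalence in [cov X], so it is rendered by the
   predicate "[(Z, f)] represents [(qFX, qF_X)]". *)
Definition is_qF (X : topologicalType) (Z : compHausType) (f : Z -> X) : Prop :=
  [/\ covering_map f, quasiF Z &
      forall (Z' : compHausType) (f' : Z' -> X),
        covering_map f' -> quasiF Z' -> cover_le f f'].

Definition dense_embedding (X Y : topologicalType) (e : X -> Y) : Prop :=
  [/\ continuous e, injective e,
      forall U : set X, open U -> exists2 V : set Y, open V & U = e @^-1` V &
      dense (range e)].

Definition is_stone_cech (X : topologicalType) (Y : compHausType)
    (e : X -> Y) : Prop :=
  dense_embedding e /\ Cstar_embedded (range e).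

End Covers.

Section VLTheory.
Context (R : realType) (A : vectorLatticeType R).
Implicit Types (x y z : A) (r : R).
Local Open Scope vlattice_scope.

Lemma vle_D x y z t : x <= y -> z <= t -> (x + z)%R <= (y + t)%R.
Proof.
move=> xy zt; apply: (@vle_trans _ _ (y + z)%R); first exact: vle_D2r.
by rewrite ![(y + _)%R]addrC; exact: vle_D2r.
Qed.

Lemma vle_sub x y : 0 <= (y - x)%R <-> x <= y.
Proof.
split=> [/(vle_D2r x)|/(vle_D2r (- x))]; first by rewrite add0r subrK.
by rewrite subrr.
Qed.

Lemma vle_scale2 r x y : (0 <= r)%R -> x <= y -> (r *: x)%R <= (r *: y)%R.
Proof.
move=> r0 /vle_sub xy; apply/vle_sub; rewrite -scalerBr; exact: vle_scale.
Qed.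

Lemma vabs_le x y : vabs x <= y <-> x <= y /\ (- x)%R <= y.
Proof.
split=> [h|[h1 h2]]; last exact: vle_join.
by split; apply: vle_trans h; [exact: vle_joinl|exact: vle_joinr].
Qed.

Lemma vle_abs x : x <= vabs x. Proof. exact: vle_joinl. Qed.
Lemma vle_absN x : (- x)%R <= vabs x. Proof. exact: vle_joinr. Qed.

Lemma vabs_ge0 x : 0 <= vabs x.
Proof.
have := vle_D (vle_abs x) (vle_absN x); rewrite subrr => h.
rewrite -[vabs x](scale1r (vabs x)).
rewrite [1%R](_ : _ = 2^-1 + 2^-1 :> R)%R; last by rewrite -div1r -splitr.
by rewrite scalerDl -scalerDr; apply: vle_scale => //; rewrite invr_ge0 ler0n.
Qed.

Lemma vabs_D x y : vabs (x + y) <= (vabs x + vabs y)%R.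
Proof.
apply/vabs_le; rewrite opprD.
by split; apply: vle_D; (exact: vle_abs || exact: vle_absN).
Qed.

Lemma vabs_Z r x : vabs (r *: x) <= (`|r| *: vabs x)%R.
Proof.
apply/vabs_le; have [r0|r0] := ger0P r.
  by split; rewrite -?scalerN; apply: vle_scale2 => //;
    (exact: vle_abs || exact: vle_absN).
have Nr0 : (0 <= - r)%R by rewrite oppr_ge0 ltW.
split; last by rewrite -scaleNr; apply: vle_scale2 => //; exact: vle_abs.
by rewrite -[r in X in X <= _]opprK scaleNr -scalerN;
  apply: vle_scale2 => //; exact: vle_absN.
Qed.

End VLTheory.

Section Yosida.
Context (R : realType) (A : wstarType R).

Definition is_ideal (I : set A) : Prop :=
  [/\ I 0, forall x y, I x -> I y -> I (x + y),
      forall (r : R) x, I x -> I (r *: x) &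
      forall x y, (vabs x <= vabs y)%VL -> I y -> I x].

Lemma ideal_vabs (I : set A) : is_ideal I -> forall x, I x -> I (vabs x).
Proof.
move=> [_ _ _ Ile] x Ix; apply: Ile (Ix); apply/vabs_le.
split; first exact: vle_refl.
apply: vle_trans (vabs_ge0 x).
by have := vle_D2r (- vabs x) (vabs_ge0 x); rewrite add0r subrr.
Qed.

Record yosida := Yosida {
  yideal :> A -> Prop;
  yideal_ideal : is_ideal yideal;
  yideal_unit : ~ yideal wunit;
  yideal_max : forall I : set A, is_ideal I -> ~ I wunit ->
    yideal `<=` I -> I = yideal
}.

HB.instance Definition _ := gen_eqMixin yosida.
HB.instance Definition _ := gen_choiceMixin yosida.

Definition hull (S : set A) : set yosida := [set M : yosida | S `<=` yideal M].

Lemma yosida_adjoin (M : yosida) (a : A) : ~ M a ->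
  exists m (r : R),
    [/\ M m, (0 < r)%R & (vabs wunit <= vabs m + r *: vabs a)%VL].
Proof.
have [M0 MD MZ Mle] := yideal_ideal M => Ma.
pose J : set A := [set x | exists m (r : R),
  [/\ M m, (0 < r)%R & (vabs x <= vabs m + r *: vabs a)%VL]].
have MJ : yideal M `<=` J.
  move=> x Mx; exists x, 1; split=> //.
  rewrite -[X in (X <= _)%VL]addr0; apply: vle_D; first exact: vle_refl.
  by apply: vle_scale => //; exact: vabs_ge0.
have vabsI := ideal_vabs (yideal_ideal M).
have JI : is_ideal J.
  split; first exact: MJ.
  - move=> x y [m [r [Mm r0 xm]]] [n [s [Mn s0 yn]]].
    exists (vabs m + vabs n), (r + s); split; [|exact: addr_gt0|].
      by apply: MD; exact: vabsI.
    apply: vle_trans (vabs_D x y) _; apply: vle_trans (vle_D xm yn) _.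
    rewrite addrACA -scalerDl; apply: vle_D; [exact: vle_abs|exact: vle_refl].
  - move=> s x [m [r [Mm r0 xm]]].
    exists (`|s| *: vabs m), (`|s| * r + 1); split.
    + by apply/MZ/vabsI.
    + by rewrite ltr_wpDl // mulr_ge0 // ltW.
    apply: vle_trans (vabs_Z s x) _.
    apply: vle_trans (vle_scale2 (normr_ge0 s) xm) _.
    rewrite scalerDr scalerA; apply: vle_D; first exact: vle_abs.
    rewrite scalerDl scale1r -[X in (X <= _)%VL]addr0.
    by apply: vle_D; [exact: vle_refl|exact: vabs_ge0].
  - move=> x y xy [m [r [Mm r0 ym]]]; exists m, r; split => //.
    exact: vle_trans xy ym.
apply: contrapT => Ju; apply: Ma.
rewrite -(yideal_max JI Ju MJ); exists 0, 1; split=> //; rewrite scale1r.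
rewrite -[X in (X <= _)%VL]add0r.
by apply: vle_D; [exact: vabs_ge0|exact: vle_refl].
Qed.

Lemma yosida_prime (M : yosida) (a b : A) :
  M (vmeet (vabs a) (vabs b)) <-> M a \/ M b.
Proof.
have [M0 MD MZ Mle] := yideal_ideal M.
have abs_abs (x : A) : (vabs x <= vabs (vabs x))%VL by exact: vle_abs.
set c := vmeet _ _.
have c0 : (0 <= c)%VL by apply: vle_meet; exact: vabs_ge0.
have cabs x : (c <= vabs x)%VL -> (vabs c <= vabs x)%VL.
  move=> cx; apply/vabs_le; split=> //; apply: vle_trans (vabs_ge0 x).
  by have := vle_D2r (- c) c0; rewrite add0r subrr.
split; last first.
  move=> [|]; apply: Mle; apply: cabs; [exact: vle_meetl|exact: vle_meetr].
move=> Mc; apply: contrapT => /not_orP[/yosida_adjoin[m [r [Mm r0 um]]]].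
move=> /yosida_adjoin[n [s [Mn s0 un]]].
apply: (@yideal_unit M).
pose t := r + s; have t0 : 0 < t by exact: addr_gt0.
have vabsI := ideal_vabs (yideal_ideal M).
pose w := vabs m + vabs n.
have key p q x : (0 <= q <= t)%R -> (vabs p <= w)%VL ->
    (vabs wunit <= vabs p + q *: vabs x)%VL ->
    (t^-1 *: (vabs wunit - w) <= vabs x)%VL.
  move=> /andP[q0 qt] pw h.
  rewrite -[vabs x]scale1r -(mulVf (lt0r_neq0 t0)) -scalerA.
  apply: vle_scale2; first by rewrite invr_ge0 ltW.
  have := vle_D2r (- w) h; move/vle_trans; apply.
  apply/vle_sub.
  rewrite (_ : _ - _ = (w - vabs p) + (t - q) *: vabs x); last first.
    by rewrite scalerBl opprB opprD addrCA [X in _ + X]addrCA addrA.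
  rewrite -[X in (X <= _)%VL]addr0; apply: vle_D; first exact/vle_sub.
  by apply: vle_scale; [rewrite subr_ge0|exact: vabs_ge0].
have ka := key m r a; have kb := key n s b.
have uc : (vabs wunit <= w + t *: c)%VL.
  have : (t^-1 *: (vabs wunit - w) <= c)%VL.
    apply: vle_meet; [apply: ka um|apply: kb un].
    - by rewrite ltW //= lerDl ltW.
    - rewrite -[X in (X <= _)%VL]addr0.
      by apply: vle_D; [exact: vle_refl|exact: vabs_ge0].
    - by rewrite ltW //= lerDr ltW.
    - rewrite -[X in (X <= _)%VL]add0r.
      by apply: vle_D; [exact: vabs_ge0|exact: vle_refl].
  move=> /(vle_scale2 (ltW t0)); rewrite scalerA mulfV ?lt0r_neq0 // scale1r.
  by move=> /(vle_D2r w); rewrite subrK addrC.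
apply: Mle (MD _ _ (MD _ _ (vabsI _ Mm) (vabsI _ Mn)) (MZ t _ Mc)).
by apply: vle_trans uc _; exact: vle_abs.
Qed.

(* The closed sets are exactly the hulls. *)
Definition yosida_open (U : set yosida) : Prop :=
  exists S : set A, U = ~` hull S.

Let yosida_openT : yosida_open setT.
Proof.
exists setT; apply/seteqP; split=> // M _ MT; apply: (@yideal_unit M).
exact: MT.
Qed.

Let yosida_openI : setI_closed yosida_open.
Proof.
move=> _ _ [S ->] [T ->].
exists [set vmeet (vabs a) (vabs b) | a in S & b in T].
rewrite -setCU; congr (~` _); apply/seteqP; split=> M.
  move=> ST _ [a Sa [b Tb <-]]; apply/yosida_prime.
  by case: ST => h; [left|right]; exact: h.
move=> h; apply: contrapT => /not_orP[/existsNP[a /not_implyP[Sa Ma]]].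
move=> /existsNP[b /not_implyP[Tb Mb]].
have /yosida_prime[//|//] : M (vmeet (vabs a) (vabs b)).
by apply: h; exists a => //; exists b.
Qed.

Let yosida_open_bigU (I : Type) (f : I -> set yosida) :
  (forall i, yosida_open (f i)) -> yosida_open (\bigcup_i f i).
Proof.
move=> /choice[S fS]; exists (\bigcup_i S i).
apply/seteqP; split=> M.
  move=> [i _]; rewrite fS => h SM; apply: h => a Sa; apply: SM.
  by exists i.
move=> /existsNP[a /not_implyP[[i _ Sa] Ma]]; exists i => //.
by rewrite fS => h; exact/Ma/h.
Qed.

HB.instance Definition _ := isOpenTopological.Build yosida
  yosida_openT yosida_openI yosida_open_bigU.

(* [nu a M] is the image of [a] in [A / M], which is a copy of [R] with [1]
   corresponding to [wunit]. *)
Definition nu (a : A) (M : yosida) : R :=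
  xget 0 [set r : R | M (a - r *: wunit)].

End Yosida.

Section V.
Context (R : realType).

(* [(H, f)] represents [(mu(qF) A, mu(qF)_A)] in [ext A] *)
Definition is_muqF (A H : wstarType R) (f : A -> H) : Prop :=
  exists (Z : compHausType) (q : Z -> yosida A) (m : A -> Cfun R Z),
    [/\ is_qF R q, forall a, funW (m a) = nu a \o q & ext_eq f m].

Definition in_V (A H : wstarType R) (f : A -> H) : Prop :=
  essential_embedding f /\ is_muqF f.

Definition V_le (A1 A2 H : wstarType R) (f1 : A1 -> H) (f2 : A2 -> H) : Prop :=
  exists2 f : A1 -> A2, essential_embedding f & f1 = f2 \o f.

Definition is_V_minimum (A H : wstarType R) (f : A -> H) : Prop :=
  in_V f /\ forall (B : wstarType R) (g : B -> H), in_V g -> V_le f g.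

End V.

(* Main.v *)
Require Import Defs.
From HB Require Import structures.
From mathcomp Require Import all_boot all_order all_algebra.
From mathcomp Require Import all_classical all_reals all_analysis.

Set Implicit Arguments.
Unset Strict Implicit.
Unset Printing Implicit Defensive.

Import Order.TTheory GRing.Theory Num.Theory.
Import numFieldNormedType.Exports.

Local Open Scope classical_set_scope.
Local Open Scope ring_scope.

(** The theorem rests on two facts about [in_V].

Construction ([in_V_pullback]). Let [S] be a vector lattice of continuous
functions on a compact Hausdorff space [X] that contains the constants and
separates points. Its Yosida space is [X]: a proper ideal of [S] has a common
zero by compactness, so the maximal ideals are the points. If [q] from [Z] to
[X] is the quasi-[F] cover, then composition with [q] embeds [S] in [C(Z)] as
the theorem's hull operator does, and this embedding is essential since [q] is
irreducible.

Rigidity ([in_V_almostP_separating]). If [K] is almost-[P], every element of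
[V(C(K))] has an image that separates the points of [K]. Indeed [K] is then a
quasi-[F] cover of the Yosida space [Y] of the element; a proper dense
cozero-set of [Y] would pull back to one of [K], so [Y] is almost-[P], hence
quasi-[F], hence equal to its own cover.

For almost-[P] spaces the quasi-[F] cover is the identity. If [K] is moreover
zero-dimensional, [F(K)] separates points and belongs to [V]; by rigidity and
Stone's argument every element of [V] contains the indicators of the clopen
sets, and these span [F(K)]. If [K] is connected, the functions constant near
[x] form an element of [V] for every point [x]; a minimum would be contained in
all of these, so it would consist of locally constant, that is constant,
functions and could not separate two points.

For the natural numbers, the Stone-Cech compactification is the quasi-[F] cover
of the one-point compactification ([stone_cech_is_qF]): in a quasi-[F] cover the
natural numbers pull back to a dense cozero-set, so maps given there extend.
Hence [F] of the one-point compactification belongs to [V]. It is contained in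
every element because essentiality alone yields the indicator of each isolated
point.

A recurring tool is that unital vector lattice homomorphisms between spaces
[C(Y)] and [C(Z)] are compositions with continuous maps
([Cfun_morphism_comp]); it also produces the extensions of maps. *)

(** * Compact Hausdorff spaces *)

Section Topology.
Context (R : realType).

(** A property of sets that holds locally and passes to subsets and finite
unions holds on compact sets: otherwise the sets whose complement in [K] has
the property form a proper filter without cluster point in [K]. *)
Lemma compact_induction (T : topologicalType) (K : set T) (P : set T -> Prop) :
  compact K -> P set0 -> (forall A B, A `<=` B -> P B -> P A) ->
  (forall A B, P A -> P B -> P (A `|` B)) ->
  (forall x, K x -> exists2 U, nbhs x U & P U) -> P K.
Proof.
move=> cK P0 Psub PU Ploc; apply: contrapT => nPK.
pose F : set_system T := [set A | P (K `\` A)].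
have FF : ProperFilter F.
  apply: Build_ProperFilter.
    by rewrite /F /= setD0.
  split; first by rewrite /F /= setDT.
    by move=> A B FA FB; rewrite /F /= setDIr; exact: PU.
  by move=> A B AB; apply: Psub; exact: setDS.
have FK : F K by rewrite /F /= setDv.
have [x [Kx clx]] := cK _ FF FK.
have [U xU PUU] := Ploc x Kx.
have FU : F (~` U) by rewrite /F /=; apply: Psub PUU => y [_ /contrapT].
by have [y [nUy Uy]] := clx _ _ FU xU.
Qed.

Lemma closed_compact (X : compHausType) (F : set X) : closed F -> compact F.
Proof. by move=> cF; apply: subclosed_compact cF compactT _. Qed.

Lemma closed_image (Z : compHausType) (X : topologicalType) (q : Z -> X)
    (F : set Z) :
  hausdorff_space X -> continuous q -> closed F -> closed (q @` F).
Proof.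
move=> hX cq cF; apply: compact_closed => //; apply: continuous_compact.
  exact: continuous_subspaceT.
exact: closed_compact.
Qed.

Lemma hausdorff_sep (T : topologicalType) (x y : T) :
  hausdorff_space T -> x <> y ->
  exists U V : set T, [/\ open U, open V, U x, V y &
    forall z, U z -> V z -> False].
Proof.
rewrite open_hausdorff => hT /eqP /hT[[U V] /= [xU yV] [oU oV /eqP UV]].
exists U, V; split=> //; [exact: set_mem|exact: set_mem|].
by move=> z Uz Vz; rewrite -[False]/(set0 z) -UV.
Qed.

Lemma closed_point (X : compHausType) (x : X) : closed [set x].
Proof. by apply: compact_closed; [exact: hausdorffT|exact: compact_set1]. Qed.

Lemma urysohn_point (X : compHausType) (V : set X) (x : X) :
  open V -> V x -> exists h : X -> R,
    [/\ continuous h, forall y, 0 <= h y, h x = 1 &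
        forall y, ~ V y -> h y = 0].
Proof.
move=> oV Vx.
have nX : normal_space X by apply: compact_normal; [exact: hausdorffT|exact: compactT].
have /(@uniform_separatorP _ R)[f [cf f01 f0 f1]] :
    uniform_separator (~` V) [set x].
  apply: (iffLR (@normal_separatorP R _) nX).
  - exact: open_closedC.
  - exact: closed_point.
  - by apply/disjoints_subset => y /= nVy yx; apply: nVy; rewrite yx.
exists f; split => //.
- move=> y; have /f01 : range f (f y) by exists y.
  by rewrite /= in_itv /= => /andP[].
- by apply: f1; exists x.
- by move=> y Vy; apply: f0; exists y.
Qed.

Lemma open_superlevel (T : topologicalType) (h : T -> R) (r : R) :
  continuous h -> open [set x | r < h x].
Proof.
move=> ch; rewrite (_ : mkset _ = h @^-1` [set y | r < y]) //.
by apply: open_comp; [move=> x _; exact: ch|exact: open_gt].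
Qed.

Lemma open_sublevel (T : topologicalType) (h : T -> R) (r : R) :
  continuous h -> open [set x | h x < r].
Proof.
move=> ch; rewrite (_ : mkset _ = h @^-1` [set y | y < r]) //.
by apply: open_comp; [move=> x _; exact: ch|exact: open_lt].
Qed.

(** The topology of a compact Hausdorff space is the weak topology of its
continuous real functions, by Urysohn. *)
Lemma continuous_weak (T : topologicalType) (Y : compHausType) (t : T -> Y) :
  (forall h : Y -> R, continuous h -> continuous (h \o t)) -> continuous t.
Proof.
move=> ht; apply/continuousP => V oV; rewrite openE => x /= Vtx.
have [h [ch h0 h1 hV]] := urysohn_point oV Vtx.
have := open_superlevel 0 (ht h ch); rewrite openE => /(_ x) /=.
rewrite h1 ltr01 => /(_ isT); apply: filterS => y /= hy.
by apply: contrapT => nVy; move: hy; rewrite hV // ltxx.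
Qed.

Lemma comp_continuous (S T U : topologicalType) (f : S -> T) (g : T -> U) :
  continuous f -> continuous g -> continuous (g \o f).
Proof. by move=> cf cg x; apply: continuous_comp; [exact: cf|exact: cg]. Qed.

Lemma dense_eq (T Y : topologicalType) (D : set T) (f g : T -> Y) :
  hausdorff_space Y -> dense D -> continuous f -> continuous g ->
  (forall x, D x -> f x = g x) -> f =1 g.
Proof.
move=> hY dD cf cg fg x; apply: contrapT => /(hausdorff_sep hY).
move=> [U [V [oU oV Ux Vx UV]]].
have [||y [[/= Uy Vy] Dy]] := dD (f @^-1` U `&` g @^-1` V).
- by exists x.
- by apply: openI; apply: open_comp.
- by apply: (UV (f y)) => //; rewrite fg.
Qed.

(** Every nonempty open subset of a cover contains the preimage of a nonempty
open set: remove the image of its complement. *)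
Lemma covering_open_preimage (Z : compHausType) (X : topologicalType)
    (q : Z -> X) (O : set Z) :
  hausdorff_space X -> covering_map q -> open O -> O !=set0 ->
  exists2 V : set X, open V & V !=set0 /\ q @^-1` V `<=` O.
Proof.
move=> hX [cq qT qirr] oO [z Oz]; exists (~` (q @` (~` O))).
  by apply: closed_openC; apply: closed_image => //; exact: open_closedC.
split; last by move=> w nw; apply: contrapT => nOw; apply: nw; exists w.
apply: contrapT => ne.
have imT : q @` (~` O) = setT.
  by apply/seteqP; split=> // x _; apply: contrapT => nx; apply: ne; exists x.
have := qirr _ (open_closedC oO) imT => /seteqP[_ /(_ z)].
by move=> /(_ I).
Qed.

Lemma covering_dense_preimage (Z : compHausType) (X : topologicalType)
    (q : Z -> X) (D : set X) :
  hausdorff_space X -> covering_map q -> dense D -> dense (q @^-1` D).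
Proof.
move=> hX cov dD O O0 oO.
have [V oV [V0 VO]] := covering_open_preimage hX cov oO O0.
have [x [Vx Dx]] := dD V V0 oV.
have [_ qT _] := cov; have : range q x by rewrite qT.
by move=> [z _ zx]; exists z; split; [apply: VO|]; rewrite /= zx.
Qed.

(** The preimage under [p] of a closed set is its image under [q], which is
compact. *)
Lemma inverse_continuous (Z : compHausType) (X : topologicalType) (q : Z -> X)
    (p : X -> Z) :
  hausdorff_space X -> continuous q -> cancel q p -> cancel p q -> continuous p.
Proof.
move=> hX cq qK pK; apply/continuous_closedP => F cF.
rewrite (_ : p @^-1` F = q @` F); first exact: closed_image.
apply/seteqP; split=> [x /= Fx|_ [z Fz <-]]; last by rewrite /= qK.
by exists (p x).
Qed.

End Topology.

(** * Unit-preserving vector lattice homomorphisms *)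

Section Morphisms.
Context (R : realType) (A B : wstarType R) (f : A -> B).
Hypothesis fm : wstar_morphism f.

Lemma wstar_morphism_lin r x y : f (r *: x + y) = r *: f x + f y.
Proof. by have [fl _ _ _] := fm; rewrite fl. Qed.

Lemma wstar_morphism0 : f 0 = 0.
Proof.
have := wstar_morphism_lin (-1) 0 0.
by rewrite scaler0 add0r scaleN1r addNr.
Qed.

Lemma wstar_morphismZ r x : f (r *: x) = r *: f x.
Proof. by have := wstar_morphism_lin r x 0; rewrite wstar_morphism0 !addr0. Qed.

Lemma wstar_morphismD x y : f (x + y) = f x + f y.
Proof. by have := wstar_morphism_lin 1 x y; rewrite !scale1r. Qed.

Lemma wstar_morphismN x : f (- x) = - f x.
Proof. by rewrite -scaleN1r wstar_morphismZ scaleN1r. Qed.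

Lemma wstar_morphismMn x n : f (x *+ n) = f x *+ n.
Proof. by rewrite -scaler_nat wstar_morphismZ scaler_nat. Qed.

Lemma wstar_morphism_abs x : f (vabs x) = vabs (f x).
Proof. by have [_ _ fj _] := fm; rewrite /vabs fj wstar_morphismN. Qed.

Lemma vle_meetP (C : wstarType R) (x y : C) : (x <= y)%VL <-> vmeet x y = x.
Proof.
split=> [xy|<-]; last exact: vle_meetr.
apply: vle_anti; first exact: vle_meetl.
by apply: vle_meet => //; exact: vle_refl.
Qed.

Lemma wstar_morphism_le x y : (x <= y)%VL -> (f x <= f y)%VL.
Proof. by have [_ fM _ _] := fm => /vle_meetP xy; apply/vle_meetP; rewrite -fM xy. Qed.

Lemma wstar_morphism_le_inj x y : injective f -> (f x <= f y)%VL -> (x <= y)%VL.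
Proof.
have [_ fM _ _] := fm => fi /vle_meetP xy; apply/vle_meetP; apply: fi.
by rewrite fM.
Qed.

End Morphisms.

(** Inside a common essential extension, comparing two lattices amounts to
comparing their images: the lift through [f2] is a homomorphism because [f2] is
injective, and it inherits essentiality from [f1]. *)
Lemma V_le_of_image (R : realType) (A1 A2 H : wstarType R) (f1 : A1 -> H)
    (f2 : A2 -> H) :
  essential_embedding f1 -> essential_embedding f2 ->
  (forall a, exists b, f2 b = f1 a) -> V_le f1 f2.
Proof.
move=> [m1 i1 e1] [m2 i2 e2] /choice[t ft]; exists t; last first.
  by apply/funext => a; rewrite /= ft.
have [l1 me1 j1 u1] := m1; have [l2 me2 j2 u2] := m2.
split; first split.
- by move=> r x y; apply: i2; rewrite l2 !ft l1.
- by move=> x y; apply: i2; rewrite me2 !ft me1.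
- by move=> x y; apply: i2; rewrite j2 !ft j1.
- by apply: i2; rewrite ft u1 u2.
- by move=> x y txy; apply: i1; rewrite -!ft txy.
move=> b [b0 bn0]; have [|a [n [a0 ab]]] := e1 (f2 b).
  split; first by rewrite -(wstar_morphism0 m2); exact: wstar_morphism_le.
  by rewrite -(wstar_morphism0 m2) => /i2.
exists a, n; split=> //; apply: (wstar_morphism_le_inj m2 i2).
by rewrite ft (wstar_morphismMn m2).
Qed.

(** * Vector lattices of continuous functions *)

Section Sublattices.
Context (R : realType).

Section Pointwise.
Context (X : Type) (S : unit_sublattice R X).
Implicit Types f g : fun_wstar S.

Lemma funW_lin r f g x : funW (r *: f + g) x = r * funW f x + funW g x.
Proof. by []. Qed.
Lemma funW0 x : funW (0 : fun_wstar S) x = 0. Proof. by []. Qed.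
Lemma funWD f g x : funW (f + g) x = funW f x + funW g x. Proof. by []. Qed.
Lemma funWN f x : funW (- f) x = - funW f x. Proof. by []. Qed.
Lemma funWZ r f x : funW (r *: f) x = r * funW f x. Proof. by []. Qed.
Lemma funW_unit x : funW (wunit : fun_wstar S) x = 1. Proof. by []. Qed.
Lemma funW_meet f g x : funW (vmeet f g) x = Num.min (funW f x) (funW g x).
Proof. by []. Qed.
Lemma funW_join f g x : funW (vjoin f g) x = Num.max (funW f x) (funW g x).
Proof. by []. Qed.
Lemma funW_abs f x : funW (vabs f) x = `|funW f x|.
Proof. by rewrite funW_join funWN -maxrN. Qed.
Lemma funWMn f n x : funW (f *+ n) x = funW f x *+ n.
Proof. by rewrite -scaler_nat funWZ mulr_natl. Qed.
Lemma funW_le f g : (f <= g)%VL <-> forall x, funW f x <= funW g x.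
Proof. by []. Qed.

Lemma funW_pos f : (0 < f)%VL -> exists x, 0 < funW f x.
Proof.
move=> [/funW_le f0 fn0]; apply: contrapT => np; apply: fn0.
apply: funW_ext => x; apply/esym/le_anti/andP; split; last exact: f0.
by rewrite leNgt; apply/negP => fx; apply: np; exists x.
Qed.

Lemma usl_const c : usl_set S (fun=> c).
Proof.
rewrite (_ : (fun=> c) = funW (c *: (wunit : fun_wstar S))); first exact: funWP.
by apply/funext => x; rewrite funWZ funW_unit mulr1.
Qed.

Lemma usl_affine r c (f : X -> R) : usl_set S f -> usl_set S (fun x => r * f x + c).
Proof. by move=> Sf; apply: usl_linear Sf (usl_const c). Qed.

End Pointwise.

Definition separating (X : Type) (S : unit_sublattice R X) :=
  forall x y, x <> y -> exists2 f, usl_set S f & f x <> f y.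

Section Compact.
Context (X : compHausType) (S : unit_sublattice R X).
Hypothesis Sc : forall f, usl_set S f -> continuous f.

(** Stone's argument: interpolate at [x] and one other point, then take minima
over the complement of [V]. *)
Lemma separating_bump (V : set X) (x : X) :
  separating S -> open V -> V x ->
  exists2 f, usl_set S f &
    [/\ forall y, 0 <= f y, f x = 1 & forall y, ~ V y -> f y = 0].
Proof.
move=> Ssep oV Vx.
pose P (A : set X) := exists2 f, usl_set S f &
  f x = 1 /\ forall y, A y -> f y <= 0.
have [||||f Sf [fx fV]] :=
    @compact_induction _ (~` V) P (closed_compact (open_closedC oV)).
- by exists (fun=> 1) => //; exact: usl_const.
- by move=> A B AB [f Sf [fx fB]]; exists f => //; split=> // y /AB /fB.
- move=> A B [f Sf [fx fA]] [g Sg [gx gB]].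
  exists (fun y => Num.min (f y) (g y)); first exact: usl_min.
  split; first by rewrite fx gx minxx.
  by move=> y [/fA|/gB] h; rewrite ge_min h ?orbT.
- move=> y Vy; have [|f Sf fxy] := Ssep x y; first by move=> xy; apply: Vy; rewrite -xy.
  have d0 : f x - f y != 0 by rewrite subr_eq0; apply/eqP.
  pose c := 2 / (f x - f y).
  pose g z := c * f z + (- c * f y - 1).
  have Sg : usl_set S g by exact: usl_affine.
  have gE z : g z = c * (f z - f y) - 1 by rewrite /g mulrBr addrA mulNr.
  exists [set z | g z < 0].
    apply: open_nbhs_nbhs; split; first exact/open_sublevel/Sc.
    by rewrite /= gE subrr mulr0 sub0r ltrN10.
  exists g => //; split=> [|z /= /ltW //].
  by rewrite gE /c divfK // [2]mulr2n addrK.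
exists (fun y => Num.max (f y) 0).
  by apply: usl_max => //; exact: usl_const.
split; first by move=> y; rewrite le_max lexx orbT.
  by rewrite fx; apply/max_idPl.
by move=> y nVy; apply/max_idPr; exact: fV.
Qed.

(** Finitely many bumps, one for each of finitely many points of [U], have a
maximum that is bounded below on [U]; it is then truncated at 1. *)
Lemma separating_clopen (U : set X) :
  separating S -> clopen U -> usl_set S (\1_U : X -> R).
Proof.
move=> Ssep [oU cU].
pose P (A : set X) := exists2 f, usl_set S f &
  [/\ forall y, 0 <= f y, forall y, ~ U y -> f y = 0 &
      forall y, A y -> 1 <= f y].
have [||||f Sf [f0 fnU fU]] := @compact_induction _ U P (closed_compact cU).
- by exists (fun=> 0); [exact: usl_const|split].
- by move=> A B AB [f Sf [f0 fU fB]]; exists f => //; split=> // y /AB /fB.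
- move=> A B [f Sf [f0 fU fA]] [g Sg [g0 gU gB]].
  exists (fun y => Num.max (f y) (g y)); first exact: usl_max.
  split=> [y|y nUy|y]; first by rewrite le_max f0.
    by rewrite fU // gU // maxxx.
  by move=> [/fA|/gB] h; rewrite le_max h ?orbT.
- move=> x Ux; have [f Sf [f0 fx fU]] := separating_bump Ssep oU Ux.
  pose g z := 2 * f z + 0.
  have Sg : usl_set S g by exact: usl_affine.
  exists [set z | 1 < g z].
    apply: open_nbhs_nbhs; split; first exact/open_superlevel/Sc.
    by rewrite /= /g fx mulr1 addr0 ltr1n.
  exists g => //; split=> [y|y nUy|y /ltW //].
    by rewrite /g addr0 mulr_ge0.
  by rewrite /g fU // mulr0 addr0.
rewrite (_ : \1_U = fun y => Num.min (f y) 1).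
  by apply: usl_min => //; exact: usl_const.
apply/funext => y; rewrite indicE; have [Uy|nUy] := pselect (U y).
  by rewrite mem_set //; apply/esym/min_idPr; exact: fU.
by rewrite memNset //; apply/esym; rewrite fnU //; apply/min_idPl.
Qed.

(** If the functions of an ideal had no common zero, a finite sum of multiples
of their absolute values would dominate the unit. *)
Lemma ideal_common_zero (I : set (fun_wstar S)) :
  is_ideal I -> ~ I wunit -> exists x, forall f, I f -> funW f x = 0.
Proof.
move=> idI Iu; have [I0 ID IZ Ile] := idI; apply: contrapT => nz.
pose P (A : set X) := exists2 f, I f &
  (forall y, 0 <= funW f y) /\ forall y, A y -> 1 <= funW f y.
have [||||f If [_ fT]] := @compact_induction _ setT P (@compactT X).
- by exists 0.
- by move=> A B AB [f If [f0 fB]]; exists f => //; split=> // y /AB /fB.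
- move=> A B [f If [f0 fA]] [g Ig [g0 gB]]; exists (f + g); first exact: ID.
  split=> y; first by rewrite funWD addr_ge0.
  rewrite funWD => -[/fA h|/gB h]; first by rewrite -[1]addr0 lerD.
  by rewrite -[1]add0r lerD.
- move=> x _; have [f If fx] : exists2 f, I f & funW f x != 0.
    apply: contrapT => nf; apply: nz; exists x => f If.
    by apply/eqP; apply: contrapT => /negP fx; apply: nf; exists f.
  pose g := (2 / `|funW f x|) *: vabs f.
  have gE y : funW g y = 2 / `|funW f x| * `|funW f y| by rewrite funWZ funW_abs.
  exists [set z | 1 < funW g z].
    apply: open_nbhs_nbhs; split; first exact/open_superlevel/Sc/funWP.
    by rewrite /= gE divfK ?normr_eq0 // ltr1n.
  exists g; first by apply: IZ; exact: ideal_vabs.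
  by split=> [y|y /ltW //]; rewrite gE mulr_ge0 // divr_ge0.
apply: Iu; apply: Ile If; apply/funW_le => y.
rewrite !funW_abs funW_unit normr1.
exact: le_trans (fT y _) (ler_norm _).
Qed.

End Compact.

Lemma Cfun_continuous (X : compHausType) (f : Cfun R X) : continuous (funW f).
Proof. exact (funWP f). Qed.

Lemma Cfun_separating (X : compHausType) : separating (usl_C R X).
Proof.
move=> x y /(hausdorff_sep (@hausdorffT X))[U [V [oU oV Ux Vy UV]]].
have [h [ch h0 hx hU]] := urysohn_point R oU Ux.
exists h => //; rewrite hx hU; first by apply/eqP; rewrite oner_eq0.
by move=> Uy; exact: UV Uy Vy.
Qed.

Lemma Cfun_inj (X : compHausType) (x y : X) :
  (forall h : Cfun R X, funW h x = funW h y) -> x = y.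
Proof.
move=> h; apply: contrapT => /(@Cfun_separating X)[f cf]; apply.
exact: (h (mk_funW cf)).
Qed.

(** For each [z], the [h] with [psi h z = 0] form a proper ideal of [C(Y)]; its
common zero is [t z]. *)
Lemma Cfun_morphism_comp (Y Z : compHausType) (psi : Cfun R Y -> Cfun R Z) :
  wstar_morphism psi -> exists2 t : Z -> Y, continuous t &
    forall h z, funW (psi h) z = funW h (t z).
Proof.
move=> pm; have [_ _ _ pu] := pm.
have /choice[t tP] : forall z, exists y, forall h, funW (psi h) z = funW h y.
  move=> z; pose I : set (Cfun R Y) := [set h | funW (psi h) z = 0].
  have [|||y Iy] := @ideal_common_zero Y (usl_C R Y) _ I.
  - by move=> f.
  - split; rewrite /I /=.
    + by rewrite (wstar_morphism0 pm).
    + by move=> x y hx hy; rewrite (wstar_morphismD pm) funWD hx hy addr0.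
    + by move=> r x hx; rewrite (wstar_morphismZ pm) funWZ hx mulr0.
    + move=> x y /(wstar_morphism_le pm) /funW_le /(_ z) + hy.
      rewrite !(wstar_morphism_abs pm) !funW_abs hy normr0 normr_le0.
      by move=> /eqP.
  - by rewrite /I /= pu funW_unit; apply/eqP; rewrite oner_eq0.
  exists y => h.
  have : I (- funW (psi h) z *: wunit + h).
    rewrite /I /= (wstar_morphism_lin pm) pu funWD funWZ funW_unit.
    by rewrite mulr1 addNr.
  move=> /Iy; rewrite funWD funWZ funW_unit mulr1 addrC => /subr0_eq.
  by move=> ->.
exists t => //; apply: (@continuous_weak R) => h ch.
rewrite (_ : h \o t = funW (psi (@mk_funW R Y (usl_C R Y) h ch))).
  exact: Cfun_continuous.
by apply/funext => z; rewrite tP.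
Qed.

(** Extending [k \o g0] for every [k] gives a homomorphism from [C(Y)] to [C(Z)],
hence a map from [Z] to [Y]. *)
Lemma Cstar_embedded_extend (Z Y : compHausType) (D : set Z) (g0 : Z -> Y) :
  dense D -> Cstar_embedded R D ->
  (forall h : Y -> R, continuous h -> {within D, continuous (h \o g0)}) ->
  exists2 g : Z -> Y, continuous g & forall z, D z -> g z = g0 z.
Proof.
move=> dD CD hg0.
have /choice[psi psiD] : forall k : Cfun R Y, exists G : Cfun R Z,
    forall z, D z -> funW G z = funW k (g0 z).
  move=> k; have [||G cG GD] := CD (funW k \o g0).
  - exact/hg0/Cfun_continuous.
  - have [M kM] := usl_bounded (funWP k); exists M => x _; exact: kM.
  - by exists (@mk_funW R Z (usl_C R Z) G cG).
have eqD (F G : Cfun R Z) : (forall z, D z -> funW F z = funW G z) -> F = G.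
  move=> FG; apply: funW_ext; apply: dense_eq dD _ _ FG.
  - exact: Rhausdorff.
  - exact: Cfun_continuous.
  - exact: Cfun_continuous.
have [|t ct tP] := @Cfun_morphism_comp Y Z psi.
  split.
  - move=> r f g; apply: eqD => z Dz.
    by rewrite !(funW_lin, psiD).
  - by move=> f g; apply: eqD => z Dz; rewrite !(funW_meet, psiD).
  - by move=> f g; apply: eqD => z Dz; rewrite !(funW_join, psiD).
  - by apply: eqD => z Dz; rewrite psiD // !funW_unit.
exists t => // z Dz; apply: Cfun_inj => k.
by rewrite -tP psiD.
Qed.

End Sublattices.

(** * Yosida spaces *)

Section VectorLatticeFacts.
Context (R : realType) (A : vectorLatticeType R).
Implicit Types (x y : A).
Local Open Scope vlattice_scope.

Lemma vabs_id x : 0 <= x -> vabs x = x.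
Proof.
move=> x0; apply: vle_anti; last exact: vle_abs.
apply/vabs_le; split; first exact: vle_refl.
apply: (vle_trans _ x0); have := vle_D2r (- x)%R x0.
by rewrite add0r subrr.
Qed.

Lemma vjoin0_ge0 x : 0 <= vjoin x 0. Proof. exact: vle_joinr. Qed.

(** The positive and negative parts of [x] are disjoint: if [c] lies below both,
then the negative part minus [c] still dominates [- x] and [0]. *)
Lemma vmeet_pos_neg x : vmeet (vjoin x 0) (vjoin (- x) 0) = 0.
Proof.
set p := vjoin x 0; set n := vjoin (- x) 0; set c := vmeet p n.
apply: vle_anti; last by apply: vle_meet; exact: vjoin0_ge0.
have pE : p <= (n + x)%R.
  apply: vle_join.
    by rewrite -[X in X <= _]add0r; apply: vle_D2r; exact: vjoin0_ge0.
  have := vle_D2r x (vle_joinl (- x) 0).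
  by rewrite addNr.
have : n <= (n - c)%R.
  apply: vle_join; last by apply/vle_sub; exact: vle_meetr.
  have : c <= (n + x)%R by apply: vle_trans pE; exact: vle_meetl.
  by move=> /(vle_D2r (- x - c)%R); rewrite addrCA subrr addr0 addrA addrK.
by move=> /(vle_D2r (c - n)%R); rewrite addrCA subrr addr0 addrA subrK subrr.
Qed.

End VectorLatticeFacts.

Section YosidaFacts.
Context (R : realType) (A : wstarType R).
Implicit Types (M N : yosida A) (a b x y : A).

Lemma ideal_le (I : set A) x y :
  is_ideal I -> (0 <= x)%VL -> (x <= y)%VL -> I y -> I x.
Proof.
move=> [_ _ _ Ile] x0 xy; apply: Ile; rewrite (vabs_id x0).
exact: vle_trans (vle_abs y).
Qed.

Lemma yosida_unit_scale M (r : R) : r != 0 -> ~ M (r *: wunit).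
Proof.
move=> r0; have [_ _ MZ _] := yideal_ideal M.
move=> /(MZ r^-1); rewrite scalerA mulVf // scale1r.
exact: yideal_unit.
Qed.

Lemma nuE a M (r : R) : M (a - r *: wunit) -> nu a M = r.
Proof.
move=> Mr; have [_ MD MZ _] := yideal_ideal M.
rewrite /nu; case: xgetP => [s -> /= Ms|/(_ r)]; last by rewrite /= => /(_ Mr).
apply: contrapT => sr; have := MD _ _ Ms (MZ (-1) _ Mr).
rewrite scaleN1r opprB addrC addrA subrK -scalerBl.
by apply: yosida_unit_scale; rewrite subr_eq0; apply/eqP => rs; apply: sr.
Qed.

Lemma nu0 a M : M a -> nu a M = 0.
Proof. by move=> Ma; apply: nuE; rewrite scale0r subr0. Qed.

Lemma yosida_ext M N : (forall a, M a <-> N a) -> M = N.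
Proof.
case: M N => [I1 p1 u1 m1] [I2 p2 u2 m2] /= eqI.
have eI : I1 = I2 by apply/funext => a; exact/propext.
by case: _ / eI p2 u2 m2 => *; congr Yosida; exact: Prop_irrelevance.
Qed.

Lemma yosida_sub_eq M N : (forall a, M a -> N a) -> M = N.
Proof.
move=> MN; apply: yosida_ext => a.
have := yideal_max (yideal_ideal N) (@yideal_unit _ _ N) MN.
by move=> <-.
Qed.

Lemma yosida_openE (U : set (yosida A)) : open U = yosida_open U.
Proof. by []. Qed.

Lemma yosida_open_notin a : open [set M : yosida A | ~ M a].
Proof.
rewrite yosida_openE; exists [set a]; apply/seteqP.
split=> M /= h; first by move=> /(_ a erefl).
by move=> Ma; apply: h => _ ->.
Qed.

(** Given [a] in [M] and not in [N], the two parts of [|a| - s u] for a small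
[s > 0] are disjoint, one lying outside [M] and the other outside [N]. *)
Lemma yosida_hausdorff : hausdorff_space (yosida A).
Proof.
rewrite open_hausdorff => M N /eqP MN.
have [a Ma Na] : exists2 a, M a & ~ N a.
  apply: contrapT => na; apply: MN; apply: yosida_sub_eq => a Ma.
  by apply: contrapT => Na; apply: na; exists a.
have [n [r [Nn r0]]] := yosida_adjoin Na.
set c := vabs a; pose u : A := wunit; rewrite (vabs_id (@wunit_ge0 R A)) => unr.
pose s := (2 * r)^-1; have s0 : 0 < s by rewrite invr_gt0 mulr_gt0.
pose y := vjoin (c - s *: u) 0; pose x := vjoin (- (c - s *: u)) 0.
have x0 : (0 <= x)%VL by exact: vjoin0_ge0.
have y0 : (0 <= y)%VL by exact: vjoin0_ge0.
have su0 (t : R) : 0 < t -> (0 <= t *: u)%VL.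
  by move=> t0; apply: vle_scale; [exact: ltW|exact: wunit_ge0].
have Mx : ~ M x.
  have iM := yideal_ideal M; have [_ MD _ _] := iM.
  move=> Mx; apply: (@yosida_unit_scale M s); first exact: lt0r_neq0.
  apply: (ideal_le iM (su0 s s0)) (MD x c Mx (ideal_vabs iM Ma)).
  have := vle_D2r c (vle_joinl (- (c - s *: u)) 0).
  by rewrite {1}opprB subrK.
have Ny : ~ N y.
  have iN := yideal_ideal N; have [_ ND NZ _] := iN.
  move=> Ny; apply: (@yosida_unit_scale N 2^-1); first by rewrite invr_eq0 pnatr_eq0.
  have h0 : 0 < (2^-1 : R) by rewrite invr_gt0.
  apply: (ideal_le iN (su0 _ h0)) (ND _ _ (ideal_vabs iN Nn) (NZ r _ Ny)).
  have cy : (c <= y + s *: u)%VL.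
    have := vle_D2r (s *: u) (vle_joinl (c - s *: u) 0).
    by rewrite subrK.
  have := vle_scale2 (ltW r0) cy => /(vle_D (vle_refl (vabs n))) /(vle_trans unr).
  rewrite scalerDr scalerA /s invfM mulrCA mulfV ?lt0r_neq0 // mulr1.
  move=> /(vle_D2r (- (2^-1 *: u))); rewrite !addrA addrK.
  have -> : (wunit - 2^-1 *: u = 2^-1 *: u :> A) => //.
  rewrite -[X in X - _](scale1r u) -scalerBl; congr (_ *: _).
  by rewrite {1}(splitr 1) div1r addrK.
exists ([set K : yosida A | ~ K x], [set K : yosida A | ~ K y]).
  by split; apply/mem_set.
split; [exact: yosida_open_notin|exact: yosida_open_notin|].
apply/eqP/seteqP; split=> // K [/= Kx Ky].
have /yosida_prime[//|//] : K (vmeet (vabs x) (vabs y)).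
rewrite !vabs_id // /x /y -[X in vmeet _ (vjoin X _)]opprK vmeet_pos_neg.
by have [] := yideal_ideal K.
Qed.

End YosidaFacts.

(** The Yosida space of a separating sublattice of [C(X)] is [X] itself. *)
Section YosidaOfSublattice.
Context (R : realType) (X : compHausType) (S : unit_sublattice R X).
Hypothesis Sc : forall f, usl_set S f -> continuous f.
Hypothesis Ssep : separating S.

Let vanishing (x : X) : set (fun_wstar S) := [set f | funW f x = 0].

Let vanishing_ideal x : is_ideal (vanishing x).
Proof.
split; rewrite /vanishing /=.
- by [].
- by move=> f g fx gx; rewrite funWD fx gx addr0.
- by move=> r f fx; rewrite funWZ fx mulr0.
- move=> f g /funW_le /(_ x) + gx; rewrite !funW_abs gx normr0 normr_le0.
  by move=> /eqP.
Qed.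

Let vanishing_unit x : ~ vanishing x wunit.
Proof. by rewrite /vanishing /= funW_unit; apply/eqP; rewrite oner_eq0. Qed.

Let vanishing_max x (I : set (fun_wstar S)) : is_ideal I -> ~ I wunit ->
  vanishing x `<=` I -> I = vanishing x.
Proof.
move=> idI Iu xI; apply/seteqP; split=> // f If.
have [y Iy] := ideal_common_zero Sc idI Iu.
have [<-|xy] := pselect (y = x); first exact: Iy.
have [g Sg gyx] := Ssep xy; exfalso; apply: gyx.
pose h : fun_wstar S := - g x *: wunit + mk_funW Sg.
have hE z : funW h z = - g x + g z by rewrite funWD funWZ funW_unit mulr1.
have /xI /Iy : vanishing x h by rewrite /vanishing /= hE addNr.
by rewrite hE addrC => /subr0_eq.
Qed.

Definition point_ideal (x : X) : yosida (fun_wstar S) :=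
  Yosida (vanishing_ideal x) (@vanishing_unit x) (@vanishing_max x).

Lemma nu_point_ideal (f : fun_wstar S) x : nu f (point_ideal x) = funW f x.
Proof.
by apply: nuE; rewrite /= /vanishing /= funWD funWN funWZ funW_unit mulr1 subrr.
Qed.

Lemma point_ideal_continuous : continuous point_ideal.
Proof.
apply/continuousP => _ [T ->]; rewrite openE => x /= /existsNP[f /not_implyP[Tf fx]].
have : open [set y | 0 < funW (vabs f) y] by exact/open_superlevel/Sc/funWP.
rewrite openE => /(_ x) /=; rewrite funW_abs normr_gt0.
move=> /(_ (introN eqP fx)); apply: filterS => y /= fy /(_ f Tf) /= fy0.
by move: fy; rewrite funW_abs fy0 normr0 ltxx.
Qed.

Lemma point_ideal_bij : exists2 p, cancel point_ideal p & cancel p point_ideal.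
Proof.
have /choice[p pE] : forall M, exists x, point_ideal x = M.
  move=> M; have [x Mx] := ideal_common_zero Sc (yideal_ideal M) (@yideal_unit _ _ M).
  by exists x; apply/esym/yosida_sub_eq => f /Mx.
exists p => [x|M]; last exact: pE.
apply: contrapT => /Ssep[f Sf]; apply.
by rewrite -[f]/(funW (mk_funW Sf)) -!nu_point_ideal pE.
Qed.

End YosidaOfSublattice.

(** * Membership in [V] *)

Section Membership.
Context (R : realType).

Lemma covering_map_homeo (Z X Y : topologicalType) (q : Z -> X) (t : X -> Y)
    (p : Y -> X) :
  covering_map q -> continuous t -> cancel t p -> cancel p t ->
  covering_map (t \o q).
Proof.
move=> [cq qT qirr] ct tK pK.
have rangeE (F : set Z) : (t \o q) @` F = setT <-> q @` F = setT.
  split=> h; apply/seteqP; split=> // y _.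
    have : ((t \o q) @` F) (t y) by rewrite h.
    by move=> [z Fz /= /(can_inj tK) <-]; exists z.
  have : (q @` F) (p y) by rewrite h.
  by move=> [z Fz zy]; exists z => //=; rewrite zy pK.
split; [exact: comp_continuous|exact/rangeE|].
by move=> F cF /rangeE; exact: qirr.
Qed.

Lemma is_qF_homeo (X Y : topologicalType) (Z : compHausType) (q : Z -> X)
    (t : X -> Y) (p : Y -> X) :
  is_qF R q -> continuous t -> continuous p -> cancel t p -> cancel p t ->
  is_qF R (t \o q).
Proof.
move=> [qcov qqF qmin] ct cp tK pK; split=> //.
  exact: covering_map_homeo qcov ct tK pK.
move=> Z' f' f'cov qFZ'.
have [g cg fg] := qmin Z' (p \o f') (covering_map_homeo f'cov cp pK tK) qFZ'.
exists g => //; apply/funext => z /=.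
by rewrite -[q (g z)]/((q \o g) z) -fg /= pK.
Qed.

Lemma is_qF_id (X : compHausType) : quasiF R X -> is_qF R (@id X).
Proof.
move=> qFX; split=> //; last by move=> Z' f' [cf' _ _] _; exists f'.
split; first by move=> x; exact: cvg_id.
  by apply/seteqP; split=> // x _; exists x.
by move=> F _; rewrite image_id.
Qed.

Lemma almostP_quasiF (X : topologicalType) : almostP R X -> quasiF R X.
Proof.
move=> PX U cU dU; rewrite (PX U cU dU) => g cg _; exists g => //.
by apply/continuous_subspace_setT.
Qed.

Lemma wstar_morphism_pullback (X Y : Type) (S : unit_sublattice R X)
    (T : unit_sublattice R Y) (q : Y -> X) (j : fun_wstar S -> fun_wstar T) :
  (forall f y, funW (j f) y = funW f (q y)) -> wstar_morphism j.
Proof.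
move=> jE; split=> [r f g|f g|f g|]; apply: funW_ext => y;
  rewrite ?(funW_lin, funW_meet, funW_join, funW_unit, jE) //.
Qed.

(** Pulling a separating sublattice back along the quasi-[F] cover gives an
element of [V]. Essentiality comes from irreducibility: a nonempty open set of
[Z] contains the preimage of a nonempty open set of [X], which carries a bump. *)
Lemma in_V_pullback (X Z : compHausType) (S : unit_sublattice R X) (q : Z -> X)
    (j : fun_wstar S -> Cfun R Z) :
  (forall f, usl_set S f -> continuous f) -> separating S -> is_qF R q ->
  (forall f z, funW (j f) z = funW f (q z)) -> in_V j.
Proof.
move=> Sc Ssep qqF jE; have jm := wstar_morphism_pullback jE.
have [qcov _ _] := qqF; have [cq qT _] := qcov.
have qsurj x : exists z, q z = x.
  have : range q x by rewrite qT.
  by move=> [z _ zx]; exists z.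
split; first split=> //.
- move=> f g fg; apply: funW_ext => x; have [z <-] := qsurj x.
  by rewrite -!jE fg.
- move=> b bp; have [z bz] := funW_pos bp.
  have [b0 _] := bp.
  pose e := funW b z / 2; have e0 : 0 < e by rewrite divr_gt0.
  have [|V oV [[v Vv] Vb]] :=
      covering_open_preimage (@hausdorffT X) qcov (open_superlevel e (@Cfun_continuous R Z b)).
    by exists z; rewrite /= /e ltr_pdivrMr // ltr_pMr // ltr1n.
  have [a Sa [a0 av aV]] := separating_bump Sc Ssep oV Vv.
  have [M aM] := usl_bounded Sa.
  have M0 : 0 <= M by exact: le_trans (aM v).
  exists (mk_funW Sa), (Num.bound (M / e)); split.
    split; first by apply/funW_le => x; exact: a0.
    move=> /(congr1 (fun f => funW f v)).
    rewrite funW0 /funW /= av; apply/eqP.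
    by rewrite eq_sym oner_eq0.
  apply/funW_le => w; rewrite jE funWMn [funW (mk_funW Sa) _]/funW /=.
  have [/Vb /= ew|nV] := pselect (V (q w)); last by rewrite aV //; apply: mulrn_wge0; exact: b0.
  apply: le_trans (le_trans (ler_norm _) (aM _)) _.
  rewrite -mulr_natl; have := archi_boundP (divr_ge0 M0 (ltW e0)) => /ltW.
  rewrite ler_pdivrMr // => /le_trans; apply.
  by rewrite ler_wpM2l // ltW.
have [p tK pK] := point_ideal_bij Sc Ssep.
have ct : continuous (point_ideal Sc Ssep) by exact: point_ideal_continuous.
have cp : continuous p by exact: inverse_continuous (@yosida_hausdorff _ _) ct tK pK.
exists Z, (point_ideal Sc Ssep \o q), j; split.
- exact: is_qF_homeo cp tK pK.
- by move=> f; apply/funext => z; rewrite jE /= nu_point_ideal.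
- by split; exists id; split.
Qed.

End Membership.

(** * The image of an element of [V] over an almost-[P] space *)

Section Image.
Context (R : realType) (B : wstarType R) (X : compHausType) (g : B -> Cfun R X).
Hypothesis gm : wstar_morphism g.

Let im : set (X -> R) := [set h | exists b, funW (g b) = h].

Let im_linear (r : R) f h : im f -> im h -> im (fun x => r * f x + h x).
Proof.
move=> [a <-] [b <-]; exists (r *: a + b).
by rewrite (wstar_morphism_lin gm); apply/funext.
Qed.

Let im_min f h : im f -> im h -> im (fun x => Num.min (f x) (h x)).
Proof.
move=> [a <-] [b <-]; exists (vmeet a b).
by have [_ -> _ _] := gm; apply/funext.
Qed.

Let im_max f h : im f -> im h -> im (fun x => Num.max (f x) (h x)).
Proof.
move=> [a <-] [b <-]; exists (vjoin a b).
by have [_ _ -> _] := gm; apply/funext.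
Qed.

Let im_one : im (fun=> 1).
Proof. by exists wunit; have [_ _ _ ->] := gm; apply/funext. Qed.

Let im_bounded f : im f -> exists M : R, forall x, `|f x| <= M.
Proof. by move=> [b <-]; exact: usl_bounded (funWP (g b)). Qed.

Definition image_usl : unit_sublattice R X :=
  UnitSublattice im_linear im_min im_max im_one im_bounded.

Lemma image_usl_continuous f : usl_set image_usl f -> continuous f.
Proof. by move=> [b <-]; exact: Cfun_continuous. Qed.

End Image.

Section AlmostP.
Context (R : realType) (K : compHausType) (B : wstarType R) (g : B -> Cfun R K).

(** Both [C(K)] and [C(Z)], for [q] from [Z] to [YB] the quasi-[F] cover, are
[mu(qF) B]; the two comparison homomorphisms are composition with maps [s] and
[t] between [Z] and [K]. Essentiality of [g] gives [s \o t = id] and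
irreducibility of [q] makes [t] surjective, so [K] and [Z] are homeomorphic and
[q \o t] is a cover of [YB]. Covers of a space with a proper dense cozero-set
have one too, so [YB] is almost-[P], hence its own quasi-[F] cover, and
minimality of [q] makes [q] injective. *)
Lemma in_V_almostP_separating (gm : wstar_morphism g) :
  almostP R K -> in_V g -> separating (image_usl gm).
Proof.
move=> PK [[_ gi gess] [Z [q [m [qqF mE [[phi phim mphi] [psi psim gpsi]]]]]]].
have [s cs sE] := Cfun_morphism_comp phim.
have [t ct tE] := Cfun_morphism_comp psim.
have mgE b z : funW (m b) z = funW (g b) (s z) by rewrite mphi /= sE.
have gmE b x : funW (g b) x = funW (m b) (t x) by rewrite {1}gpsi /= tE.
have mm : wstar_morphism m.
  have [gl gme gj gu] := gm; have [pl pme pj pu] := phim.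
  rewrite mphi; split=> [r x y|x y|x y|] /=.
  - by rewrite gl pl.
  - by rewrite gme pme.
  - by rewrite gj pj.
  - by rewrite gu pu.
have [[cq qT qirr] qFZ qmin] := qqF.
have hY : hausdorff_space (yosida B) by exact: yosida_hausdorff.
(* [yosida_adjoin] transported along [m] replaces the existence of the value of
   [b] at an arbitrary maximal ideal. *)
have qP z b : q z b <-> funW (m b) z = 0.
  split=> [qzb|mb0]; first by rewrite mE /= nu0.
  apply: contrapT => /yosida_adjoin[n [r [qn r0 un]]].
  have := wstar_morphism_le mm un => /funW_le /(_ z).
  rewrite (wstar_morphismD mm) (wstar_morphismZ mm) !(wstar_morphism_abs mm).
  have [_ _ _ ->] := mm.
  rewrite funWD funWZ !funW_abs funW_unit mb0 mE /= nu0 //.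
  by rewrite normr0 mulr0 addr0 normr1 ler10.
have q_eq z w : q z = q w <-> forall b, funW (m b) z = funW (m b) w.
  split=> [qzw b|mzw]; first by rewrite mE /= qzw.
  by apply: yosida_ext => b; rewrite !qP mzw.
(* If [s (t x)] differed from [x], some open [O] around [x] would be mapped off
   itself by [s \o t]. Elements of the image are invariant under [s \o t], so
   only 0 vanishes outside [O], whereas essentiality provides another one. *)
have stK : cancel t s.
  move=> x; apply: contrapT => /(hausdorff_sep (@hausdorffT K)).
  move=> [V [U [oV oU Vstx Ux VU]]].
  pose O := U `&` (s \o t) @^-1` V.
  have oO : open O.
    apply: openI => //; apply: open_comp => // y _.
    exact: comp_continuous.
  have [h [ch h0 hx hO]] := urysohn_point R oO (conj Ux Vstx).
  pose hh : Cfun R K := @mk_funW R K (usl_C R K) h ch.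
  have [|b [n [[b0 bn0] bh]]] := gess hh.
    split; first by apply/funW_le.
    move=> /(congr1 (fun f => funW f x)); rewrite funW0 /funW /= hx.
    by apply/eqP; rewrite eq_sym oner_eq0.
  have [|y gy] := @funW_pos _ _ _ (g b).
    split; first by rewrite -(wstar_morphism0 gm); exact: wstar_morphism_le.
    by rewrite -(wstar_morphism0 gm) => /gi.
  have gpos z : 0 < funW (g b) z -> O z.
    move=> gz; apply: contrapT => nOz.
    have := iffLR (funW_le _ _) bh z; rewrite funWMn [funW hh z]/funW /= hO //.
    by rewrite mul0rn leNgt gz.
  have [Uy Vy] := gpos y gy; move: gy; rewrite gmE mgE => /gpos[Usy _].
  exact: VU Vy Usy.
(* [q \o t \o s = q], so the closed set [range t] has full image under [q]. *)
have tsurj z : exists x, t x = z.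
  have : range t z; last by move=> [x _ <-]; exists x.
  suff -> : range t = setT by [].
  apply: qirr; first by apply: closed_image => //; exact: hausdorffT.
  apply/seteqP; split=> // M _.
  have : range q M by rewrite qT.
  move=> [w _ <-]; exists (t (s w)); first by exists (s w).
  by apply/q_eq => b; rewrite -gmE -mgE.
have tsK : cancel s t by move=> z; have [x <-] := tsurj z; rewrite stK.
have cY : compact [set: yosida B].
  by rewrite -qT; apply: continuous_compact compactT; exact: continuous_subspaceT.
have PY : almostP R (yosida B).
  move=> U [h ch ->] dU; apply/seteqP; split=> // M _ /=.
  have : range q M by rewrite qT.
  move=> [z _ <-]; have [x <-] := tsurj z.
  suff : [set y | h (q (t y)) != 0] x by [].
  rewrite (PK [set y | h (q (t y)) != 0]) //.
    exists (h \o (q \o t)) => //.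
    by apply: comp_continuous ch; exact: comp_continuous.
  move=> O [y Oy] oO.
  have [||z' [/= Oz' hz']] := covering_dense_preimage hY (And3 cq qT qirr) dU
    (O := s @^-1` O).
  - by exists (t y); rewrite /= stK.
  - by apply: open_comp.
  - by exists (s z'); split=> //=; rewrite tsK.
pose Y : compHausType := HB.pack (yosida B)
  (Topological_isCompactHausdorff.Build (yosida B) cY hY).
have [qid _ _] := @is_qF_id R Y (almostP_quasiF PY).
have [p cp qpK] := qmin Y id qid (almostP_quasiF PY).
have qpM M : q (p M) = M by rewrite -[LHS]/((q \o p) M) -qpK.
have psurj z : exists M, p M = z.
  have : range p z; last by move=> [M _ <-]; exists M.
  suff -> : range p = setT by [].
  apply: qirr; first by apply: (@closed_image Y) => //; exact: hausdorffT.
  by apply/seteqP; split=> // M _; exists (p M) => //; exists M.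
move=> x y xy; apply: contrapT => gxy; apply: xy.
suff : t x = t y by exact: can_inj stK _ _.
have : q (t x) = q (t y).
  apply/q_eq => b; rewrite -!gmE; apply: contrapT => bxy.
  by apply: gxy; exists (funW (g b)) => //; exists b.
have [M <-] := psurj (t x); have [N <-] := psurj (t y).
by rewrite !qpM => ->.
Qed.

End AlmostP.

(** * Functions of finite range *)

Section FiniteRange.
Context (R : realType).

Lemma usl_sum (X : Type) (S : unit_sublattice R X) (I : Type) (s : seq I)
    (c : I -> R) (h : I -> X -> R) :
  (forall i, usl_set S (h i)) ->
  usl_set S (fun x => \sum_(i <- s) c i * h i x).
Proof.
move=> Sh; elim: s => [|i s IH].
  by under eq_fun do rewrite big_nil; exact: usl_const.
by under eq_fun do rewrite big_cons; exact: usl_linear (Sh i) IH.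
Qed.

Lemma usl_finite_range (X : Type) (S : unit_sublattice R X) (f : X -> R) :
  finite_set (range f) ->
  (forall r, usl_set S (\1_(f @^-1` [set r]) : X -> R)) -> usl_set S f.
Proof.
move=> /finite_seqP[s fs] Sf.
rewrite (_ : f = fun x => \sum_(r <- undup s) r * \1_(f @^-1` [set r]) x).
  exact: usl_sum.
apply/funext => x; rewrite (bigD1_seq (f x)) ?undup_uniq //=; last first.
  have : range f (f x) by exists x.
  by rewrite fs mem_undup.
rewrite indicE mem_set // mulr1 big1_seq ?addr0 // => r /andP[rfx _].
by rewrite indicE memNset ?mulr0 //= => /eqP; rewrite eq_sym (negPf rfx).
Qed.

Lemma finite_range_clopen (T : topologicalType) (f : T -> R) (r : R) :
  continuous f -> finite_set (range f) -> clopen (f @^-1` [set r]).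
Proof.
move=> cf ff; have clF (F : set R) : finite_set F -> closed (f @^-1` F).
  move=> finF; apply: (iffLR (continuous_closedP f) cf).
  by apply: compact_closed; [exact: Rhausdorff|exact: finite_compact].
split; last by apply: clF; exact: finite_set1.
rewrite (_ : _ @^-1` _ = ~` (f @^-1` (range f `\ r))).
  by apply: closed_openC; apply: clF; exact: finite_setD.
apply/seteqP; split=> x /=; first by move=> -> [].
by move=> h; apply: contrapT => fxr; apply: h; split=> //; exists x.
Qed.

Lemma locally_constant_within (T Y : topologicalType) (D : set T) (g : T -> Y) :
  (forall x, D x -> exists2 U : set T, open U &
     U x /\ forall y, U y -> D y -> g y = g x) ->
  {within D, continuous g}.
Proof.
move=> lc; apply/subspace_continuousP => x Dx W Wgx.
have [U oU [Ux Ug]] := lc x Dx.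
rewrite nbhs_simpl /= /within /=.
have : nbhs x U by exact: open_nbhs_nbhs.
apply: filterS => y Uy Dy; rewrite /= /from_subspace Ug //.
exact: nbhs_singleton.
Qed.

Lemma indic_clopen_continuous (T : topologicalType) (U : set T) :
  clopen U -> continuous (\1_U : T -> R).
Proof.
move=> [oU cU]; apply/continuous_subspace_setT/locally_constant_within => x _.
have [Ux|nUx] := pselect (U x).
  by exists U => //; split=> // y Uy _; rewrite !indicE !mem_set.
exists (~` U); first exact: closed_openC.
by split=> // y nUy _; rewrite !indicE !memNset.
Qed.

Lemma indic_clopen_F (X : compHausType) (U : set X) :
  clopen U -> usl_set (usl_F R X) (\1_U : X -> R).
Proof.
move=> cU; split; first exact: indic_clopen_continuous.
apply: (@sub_finite_set _ _ [set 0; 1]); last exact: finite_set2.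
by move=> _ [x _ <-]; rewrite indicE; case: (_ \in _); [right|left].
Qed.

Lemma usl_F_continuous (X : compHausType) f :
  usl_set (usl_F R X) f -> continuous f.
Proof. by case. Qed.

Lemma usl_F_separating (X : compHausType) :
  (forall x y : X, x <> y -> exists U, [/\ clopen U, U x & ~ U y]) ->
  separating (usl_F R X).
Proof.
move=> Xsep x y /Xsep[U [cU Ux nUy]]; exists (\1_U); first exact: indic_clopen_F.
by rewrite !indicE mem_set // memNset //; apply/eqP; rewrite oner_eq0.
Qed.

Lemma basis_clopen_sep (X : compHausType) :
  basis [set U : set X | clopen U] ->
  forall x y : X, x <> y -> exists U, [/\ clopen U, U x & ~ U y].
Proof.
move=> [_ bX] x y xy.
have [|U [cU Ux] Uy] := bX x (~` [set y]).
  by apply: open_nbhs_nbhs; split=> //; apply: closed_openC; exact: closed_point.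
by exists U; split=> // /Uy; apply.
Qed.

(** Every element of [V] separates points, so it contains the indicators of the
clopen sets, and these span [F(K)]. *)
Theorem zero_dimensional_almostP_minimum (K : compHausType) :
  basis [set U : set K | clopen U] -> almostP R K ->
  is_V_minimum (fun f : Ffun R K => F_incl f).
Proof.
move=> bK PK.
have inV : in_V (fun f : Ffun R K => F_incl f).
  apply: in_V_pullback (@usl_F_continuous K) _ (is_qF_id (almostP_quasiF PK)) _.
    exact/usl_F_separating/basis_clopen_sep.
  by [].
split=> // B g gV; apply: V_le_of_image; [exact: inV.1|exact: gV.1|].
move=> f; have [[gm _ _] _] := gV.
have [fc ff] := funWP f.
have [|b gb] := @usl_finite_range _ (image_usl gm) (funW f) ff.
  move=> r; apply: separating_clopen; first exact: image_usl_continuous.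
    exact: in_V_almostP_separating.
  exact: finite_range_clopen.
by exists b; apply: funW_ext => x; rewrite gb.
Qed.

End FiniteRange.

(** * Functions constant near a point *)

Section ConstantNear.
Context (R : realType) (K : compHausType) (x : K).

Let near_const : set (K -> R) :=
  [set f | continuous f /\ \forall y \near x, f y = f x].

Let near_op2 (op : R -> R -> R) f g : near_const f -> near_const g ->
  \forall y \near x, op (f y) (g y) = op (f x) (g x).
Proof. by move=> [_ fx] [_ gx]; apply: filterS2 fx gx => y -> ->. Qed.

Let near_linear (r : R) f g : near_const f -> near_const g ->
  near_const (fun y => r * f y + g y).
Proof.
move=> nf ng; split; last exact: (near_op2 (fun a b => r * a + b)).
exact: (@usl_linear _ _ (usl_C R K) r f g nf.1 ng.1).
Qed.

Let near_min f g : near_const f -> near_const g ->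
  near_const (fun y => Num.min (f y) (g y)).
Proof.
move=> nf ng; split; last exact: (near_op2 Num.min).
exact: (@usl_min _ _ (usl_C R K) f g nf.1 ng.1).
Qed.

Let near_max f g : near_const f -> near_const g ->
  near_const (fun y => Num.max (f y) (g y)).
Proof.
move=> nf ng; split; last exact: (near_op2 Num.max).
exact: (@usl_max _ _ (usl_C R K) f g nf.1 ng.1).
Qed.

Let near_one : near_const (fun=> 1).
Proof. by split; [exact: (@usl_one _ _ (usl_C R K))|exact: nearW]. Qed.

Let near_bounded f : near_const f -> exists M : R, forall y, `|f y| <= M.
Proof. by move=> [cf _]; exact: (@usl_bounded _ _ (usl_C R K) f cf). Qed.

Definition usl_const_near : unit_sublattice R K :=
  UnitSublattice near_linear near_min near_max near_one near_bounded.

Lemma usl_const_near_continuous f : usl_set usl_const_near f -> continuous f.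
Proof. by case. Qed.

Lemma usl_const_near_separating : separating usl_const_near.
Proof.
suff sep y z : y <> x -> y <> z -> exists2 f, usl_set usl_const_near f & f y <> f z.
  move=> y z yz; have [yx|yx] := pselect (y = x); last exact: sep.
  have [||f Sf fzy] := sep z y; first by move=> zx; apply: yz; rewrite zx.
    by move=> zy; exact: yz.
  by exists f => // fyz; apply: fzy.
move=> yx yz.
have [||h [ch h0 hy hV]] := @urysohn_point R K (~` [set x] `&` ~` [set z]) y.
- by apply: openI; apply: closed_openC; exact: closed_point.
- by split.
have hx : h x = 0 by apply: hV => -[/(_ erefl)].
have hz : h z = 0 by apply: hV => -[_ /(_ erefl)].
(* [2 h - 1] is negative near [x]. *)
pose f w := Num.max (2 * h w + - 1) 0.
have fx : f x = 0 by rewrite /f hx mulr0 add0r; apply/max_idPr; rewrite oppr_le0.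
exists f.
  split.
    apply: (@usl_max _ _ (usl_C R K)); first exact: (@usl_affine _ _ (usl_C R K)).
    exact: usl_const.
  have : nbhs x [set w | h w < 2^-1].
    apply: open_nbhs_nbhs; split; first exact: open_sublevel.
    by rewrite /= hx invr_gt0.
  apply: filterS => w /= hw; rewrite fx; apply/max_idPr.
  by rewrite subr_le0 mulrC -ler_pdivlMr // div1r ltW.
rewrite /f hy hz mulr1 mulr0 add0r [2]mulr2n addrK.
rewrite (max_idPl _) ?ler01 // (max_idPr _) ?oppr_le0 ?ler01 //.
by apply/eqP; rewrite oner_eq0.
Qed.

End ConstantNear.

Section Connected.
Context (R : realType) (K : compHausType).

Lemma connected_locally_constant (f : K -> R) :
  connected [set: K] -> continuous f ->
  (forall x, \forall y \near x, f y = f x) -> forall x y, f x = f y.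
Proof.
move=> cK cf fl x y.
have : [set z | f z = f y] = setT.
  apply: cK; first by exists y.
    exists [set z | f z = f y]; last by rewrite setTI.
    by rewrite openE => z /= fz; have := fl z; apply: filterS => w /= ->.
  exists [set z | f z = f y]; last by rewrite setTI.
  apply: (iffLR (continuous_closedP f) cf [set f y]).
  by apply: compact_closed; [exact: Rhausdorff|exact: compact_set1].
by move=> /seteqP[_ /(_ x I)].
Qed.

(** The functions constant near [x] form an element of [V] for each [x],
and on a connected space only the constants lie in all of them. *)
Theorem connected_almostP_no_minimum :
  connected [set: K] -> (exists x y : K, x <> y) -> almostP R K ->
  ~ exists (A : wstarType R) (f : A -> Cfun R K), is_V_minimum f.
Proof.
move=> cK [x [y xy]] PK [A [f [fV fmin]]].
have [[fm _ _] _] := fV.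
have [_ [a <-]] := in_V_almostP_separating fm PK fV xy; apply.
apply: connected_locally_constant => //; first exact: Cfun_continuous.
move=> z; pose j (h : fun_wstar (usl_const_near R z)) : Cfun R K :=
  @mk_funW R K (usl_C R K) h (usl_const_near_continuous (funWP h)).
have jV : in_V j.
  apply: in_V_pullback (@usl_const_near_continuous R K z) _
    (is_qF_id (almostP_quasiF PK)) _ => //.
  exact: usl_const_near_separating.
have [t _ ->] := fmin _ j jV.
by have [] := funWP (t a).
Qed.

End Connected.

(** * The Stone-Cech compactification of the natural numbers *)

Section AlphaN.

Lemma compact_nat_bounded (C : set nat) :
  compact C -> exists N, forall n, C n -> (n < N)%N.
Proof.
move=> cC; pose P (A : set nat) := exists N, forall n, A n -> (n < N)%N.
apply: (@compact_induction _ C P cC).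
- by exists 0%N.
- by move=> A B AB [N BN]; exists N => n /AB /BN.
- move=> A B [N AN] [M BM]; exists (maxn N M) => n.
  by rewrite leq_max => -[/AN ->|/BM ->]; rewrite ?orbT.
- move=> n _; exists [set n]; first exact: discrete_set1.
  by exists n.+1 => m ->.
Qed.

Lemma nbhs_infty_alphaN (U : set alphaN) :
  nbhs (None : alphaN) U <->
  U None /\ exists N, forall n, (N <= n)%N -> U (Some n).
Proof.
split=> [|[U0 [N UN]]].
  move=> [C [cC _] CU]; split; first by apply: CU; right.
  have [N CN] := compact_nat_bounded cC; exists N => n Nn.
  apply: CU; left; exists n => // Cn.
  by have := CN n Cn; rewrite ltnNge Nn.
exists `I_N; first by split; [exact/finite_compact/finite_II|exact: discrete_closed].
move=> _ [[n /= nN <-]|->] //; apply: UN.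
by rewrite leqNgt; apply/negP.
Qed.

Lemma open_point_alphaN n : open [set (Some n : alphaN)].
Proof.
rewrite -image_set1.
exact/one_point_compactification_open_some/discrete_open.
Qed.

Lemma clopen_point_alphaN n : clopen [set (Some n : alphaN)].
Proof. by split; [exact: open_point_alphaN|exact: closed_point]. Qed.

Lemma dense_nat_alphaN : dense (range (Some : nat -> alphaN)).
Proof.
move=> O [[n|] On] oO; first by exists (Some n); split=> //; exists n.
have /nbhs_infty_alphaN[_ [N ON]] : nbhs (None : alphaN) O by exact: open_nbhs_nbhs.
by exists (Some N); split; [exact: ON|exists N].
Qed.

Lemma alphaN_clopen_sep (x y : alphaN) :
  x <> y -> exists U, [/\ clopen U, U x & ~ U y].
Proof.
case: x => [n|] xy.
  by exists [set Some n]; split=> //; [exact: clopen_point_alphaN|move=> yn; exact: xy].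
case: y xy => [n|//] _; exists (~` [set Some n]); split=> //.
  have [oS cS] := clopen_point_alphaN n.
  by split; [exact: closed_openC|exact: open_closedC].
by apply.
Qed.

Lemma nat_cozero_alphaN (R : realType) :
  cozero R (range (Some : nat -> alphaN)).
Proof.
pose h (x : alphaN) : R := if x is Some n then n.+1%:R^-1 else 0.
exists h; last first.
  apply/seteqP; split=> [_ [n _ <-]|[n|] /=]; rewrite /= ?eqxx //.
  by exists n.
move=> x W Wh; suff: nbhs x (h @^-1` W) by [].
case: x Wh => [n|] Wh.
  have : nbhs (Some n : alphaN) [set (Some n : alphaN)].
    by apply: open_nbhs_nbhs; split=> //; exact: open_point_alphaN.
  apply: (@filterS _ (nbhs (Some n : alphaN)) (@nbhs_filter alphaN (Some n))).
  by move=> _ ->; exact: nbhs_singleton.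
apply/nbhs_infty_alphaN; split; first exact: nbhs_singleton.
move/nbhs_ballP: Wh => [e /= e0 eW]; exists (Num.bound e^-1) => n en.
apply: eW; rewrite /ball /= sub0r normrN ger0_norm ?invr_ge0 //.
rewrite invf_plt ?posrE //; apply: lt_le_trans (archi_boundP _) _.
  by rewrite invr_ge0 ltW.
by rewrite ler_nat leqW.
Qed.

End AlphaN.

Section BetaN.
Context (R : realType) (bN : compHausType) (e : nat -> bN).
Hypothesis ebN : is_stone_cech R e.

Let e_inj : injective e. Proof. by have [[]] := ebN. Qed.
Let e_dense : dense (range e). Proof. by have [[]] := ebN. Qed.

(** An open set that meets the dense image of [e] only in [e n] is reduced to that
point, because the complement of a point is open. *)
Lemma stone_cech_open_point n : open [set e n].
Proof.
have [[_ _ e_open _] _] := ebN.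
have [V oV nV] := e_open [set n] (@discrete_open _ _).
rewrite (_ : [set e n] = V) //; apply/seteqP; split=> z.
  move=> ->; have : (e @^-1` V) n by rewrite -nV.
  by [].
move=> Vz; apply: contrapT => zn.
have [||w [[Vw wn] [m _ mw]]] := e_dense (O := V `&` ~` [set e n]).
- by exists z.
- by apply: openI => //; apply: closed_openC; exact: closed_point.
- have : (e @^-1` V) m by rewrite /= mw.
  by rewrite -nV => mn; apply: wn; rewrite -mw mn.
Qed.

Lemma stone_cech_clopen_point n : clopen [set e n].
Proof. by split; [exact: stone_cech_open_point|exact: closed_point]. Qed.

(** Any map on the discrete set of the [e n] is continuous there, and that set is
[C*]-embedded. *)
Lemma stone_cech_alphaN : exists2 q : bN -> alphaN, continuous q &
  forall n, q (e n) = Some n.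
Proof.
have /choice[g0 g0E] : forall z, exists y : alphaN, forall n, e n = z -> y = Some n.
  move=> z; have [[n nz]|nz] := pselect (exists n, e n = z).
    by exists (Some n) => m; rewrite -nz => /e_inj ->.
  by exists None => n ez; exfalso; apply: nz; exists n.
have [_ eC] := ebN; have [|q cq qE] := Cstar_embedded_extend e_dense eC (g0 := g0).
  move=> h _; apply: locally_constant_within => _ [n _ <-].
  by exists [set e n]; [exact: stone_cech_open_point|split=> // _ ->].
by exists q => // n; rewrite qE; [exact: g0E|exists n].
Qed.

(** A dense cozero-set contains the isolated points [e n], so it inherits
[C*]-embeddedness from their set. *)
Lemma stone_cech_quasiF : quasiF R bN.
Proof.
move=> U [h ch Uh] dU g gc [M gM].
have oU : open U.
  rewrite Uh (_ : [set x | _] = h @^-1` (~` [set 0])); last first.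
    by apply/seteqP; split=> x /=; move/eqP.
  apply: open_comp => [x _|]; first exact: ch.
  apply: closed_openC; apply: compact_closed; [exact: Rhausdorff|exact: compact_set1].
have eU n : U (e n).
  by have [w [->]] := dU _ (ex_intro _ (e n) erefl) (stone_cech_open_point n).
have [_ eC] := ebN; have [||G cG Ge] := eC g.
- by apply: continuous_subspaceW gc => _ [n _ <-].
- by exists M => _ [n _ <-]; exact: gM.
exists G => // x Ux; apply: contrapT => /(hausdorff_sep (@Rhausdorff R)).
move=> [V [W [oV oW VG Wg VW]]].
have gx : nbhs x (g @^-1` W).
  have := gc; rewrite continuous_open_subspace // => /(_ x (mem_set Ux)); apply.
  exact: open_nbhs_nbhs.
have Gx : nbhs x (G @^-1` V) by apply: cG; exact: open_nbhs_nbhs.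
have : nbhs x (g @^-1` W `&` G @^-1` V) by exact: filterI.
rewrite nbhsE => -[N [oN Nx] NVW].
have [w [Nw [n _ nE]]] := e_dense (ex_intro _ x Nx) oN.
have [/= Wn Vn] := NVW _ Nw.
by apply: VW Vn _; rewrite Ge //; exists n.
Qed.

Section Cover.
Context (q : bN -> alphaN).
Hypotheses (cq : continuous q) (qe : forall n, q (e n) = Some n).

Lemma stone_cech_fiber z n : q z = Some n -> z = e n.
Proof.
move=> qz; apply: contrapT => zn.
have [||w [[wn qw] [m _ mw]]] :=
    e_dense (O := ~` [set e n] `&` q @^-1` [set Some n]).
- by exists z.
- apply: openI; first by apply: closed_openC; exact: closed_point.
  by apply: open_comp; [move=> w _; exact: cq|exact: open_point_alphaN].
- by move: qw wn; rewrite /= -mw qe => -[->].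
Qed.

Lemma stone_cech_covering : covering_map q.
Proof.
split=> //.
  apply/seteqP; split=> // x _; apply: contrapT => nx.
  have [||w [nw [n _ nE]]] := dense_nat_alphaN (O := ~` range q).
  - by exists x.
  - apply: closed_openC; apply: closed_image => //.
    exact: hausdorffT.
  - by apply: nw; rewrite -nE -qe; exists (e n).
move=> F cF qF; apply: contrapT => FT.
have [z nFz] : exists z, ~ F z.
  apply: contrapT => nz; apply: FT; apply/seteqP; split=> // z _.
  by apply: contrapT => nFz; apply: nz; exists z.
have [||w [nFw [n _ nE]]] := e_dense (O := ~` F).
- by exists z.
- exact: closed_openC.
- have : (q @` F) (Some n) by rewrite qF.
  by move=> [z' Fz' /stone_cech_fiber z'n]; apply: nFw; rewrite -nE -z'n.
Qed.

(** In a quasi-[F] cover [f'] of the one-point compactification, the preimage of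
the natural numbers is a dense cozero-set on which the map to [bN] is locally
constant, hence it extends. *)
Lemma stone_cech_is_qF : is_qF R q.
Proof.
split; [exact: stone_cech_covering|exact: stone_cech_quasiF|].
move=> Z f fcov qFZ; have [cf _ _] := fcov.
pose W : set Z := f @^-1` range (Some : nat -> alphaN).
have dW : dense W.
  apply: covering_dense_preimage fcov dense_nat_alphaN; exact: hausdorffT.
have cW : cozero R W.
  have [h ch hE] := nat_cozero_alphaN R; exists (h \o f).
    exact: comp_continuous.
  by rewrite /W hE.
pose g0 z := e (odflt 0%N (f z)).
have [|g cg gE] := Cstar_embedded_extend dW (qFZ W cW dW) (g0 := g0).
  move=> h _; apply: locally_constant_within => z [n _ nz].
  exists (f @^-1` [set Some n]).
    by apply: open_comp; [move=> w _; exact: cf|exact: open_point_alphaN].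
  by split=> // w /= wn _; rewrite /g0 -nz wn.
exists g => //; apply/funext; apply: dense_eq dW cf (comp_continuous cg cq) _.
  exact: hausdorffT.
by move=> z Wz; rewrite /= gE // /g0; case: Wz => n _ <-; rewrite qe.
Qed.

End Cover.

(** An element of the image lying below a multiple of the indicator of an isolated
point is itself a multiple of that indicator, and essentiality provides one. *)
Lemma essential_image_point (B : wstarType R) (g : B -> Cfun R bN)
    (gm : wstar_morphism g) n :
  essential_embedding g -> usl_set (image_usl gm) (\1_[set e n] : bN -> R).
Proof.
move=> [_ gi gess].
pose b : Cfun R bN := @mk_funW R bN (usl_C R bN) (\1_[set e n])
  (indic_clopen_continuous (stone_cech_clopen_point n)).
have bE z : funW b z = \1_[set e n] z by [].
have [|a [k [[a0 an0] ab]]] := gess b.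
  split; first by apply/funW_le => z; rewrite bE indicE ler0n.
  move=> /(congr1 (fun f => funW f (e n))); rewrite funW0 bE indicE mem_set //.
  by apply/eqP; rewrite eq_sym oner_eq0.
have ga0 : (0 <= g a)%VL.
  by rewrite -(wstar_morphism0 gm); exact: wstar_morphism_le.
have gan z : z <> e n -> funW (g a) z = 0.
  move=> zn; apply: le_anti; apply/andP; split; last exact: ga0.
  have := iffLR (funW_le _ _) ab z.
  by rewrite funWMn bE indicE memNset // mul0rn.
have [|z gaz] := @funW_pos _ _ _ (g a).
  by split=> //; rewrite -(wstar_morphism0 gm) => /gi.
have zn : z = e n by apply: contrapT => /gan z0; move: gaz; rewrite z0 ltxx.
exists ((funW (g a) z)^-1 *: a); apply/funext => w.
rewrite (wstar_morphismZ gm) funWZ indicE.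
have [->|wn] := pselect (w = e n).
  by rewrite mem_set // -zn mulVf // lt0r_neq0.
by rewrite memNset // (gan w wn) mulr0.
Qed.

(** A function on the one-point compactification with finite range is a
finite linear combination of the unit and indicators of isolated points. *)
Theorem stone_cech_minimum : exists j : Ffun R alphaN -> Cfun R bN,
  (forall (f : Ffun R alphaN) (n : nat), funW (j f) (e n) = funW f (Some n)) /\
  is_V_minimum j.
Proof.
have [q cq qe] := stone_cech_alphaN.
pose j (f : Ffun R alphaN) : Cfun R bN := @mk_funW R bN (usl_C R bN) (funW f \o q)
  (comp_continuous cq (usl_F_continuous (funWP f))).
exists j; split=> [f n|]; first by rewrite -qe.
have jV : in_V j.
  apply: in_V_pullback (@usl_F_continuous R alphaN) _ (stone_cech_is_qF cq qe) _ => //.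
  exact/usl_F_separating/alphaN_clopen_sep.
split=> // B g gV; apply: V_le_of_image; [exact: jV.1|exact: gV.1|].
move=> f; have [gess _] := gV; have [gm _ _] := gess.
have [cf ff] := funWP f.
have [|_ [N fN]] := iffLR (nbhs_infty_alphaN (funW f @^-1` [set funW f None])).
  apply: open_nbhs_nbhs; split=> //.
  by have [] := finite_range_clopen (funW f None) cf ff.
pose c n := funW f (Some n) - funW f None.
have : usl_set (image_usl gm) (fun z => 1 *
    (\sum_(n <- index_iota 0 N) c n * \1_[set e n] z) + funW f None).
  by apply: usl_affine; apply: usl_sum => n; exact: essential_image_point.
move=> [b gb]; exists b; apply: funW_ext => z; rewrite gb mul1r.
rewrite -[funW (j f) z]/(funW f (q z)).
case qz: (q z) => [m|].
  rewrite (stone_cech_fiber cq qe qz).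
  have [mN|Nm] := ltnP m N.
    rewrite (bigD1_seq m) ?iota_uniq ?mem_index_iota //= indicE mem_set // mulr1.
    rewrite big1 ?addr0 ?subrK // => n nm.
    rewrite indicE memNset ?mulr0 //= => /e_inj mn.
    by move: nm; rewrite mn eqxx.
  rewrite big1_seq ?add0r; first by rewrite -(fN m Nm).
  move=> n /=; rewrite mem_index_iota => /= nN.
  rewrite indicE memNset ?mulr0 //= => /e_inj mn.
  by move: nN; rewrite -mn ltnNge Nm.
rewrite big1 ?add0r // => n _; rewrite indicE memNset ?mulr0 //= => zn.
by move: qz; rewrite zn qe.
Qed.

End BetaN.

(* In (i) the embedding [j] is the one sending a function on the one-point
   compactification to the continuous extension of its restriction to [nat]. *)
Theorem theorem7p11 (R : realType) :
  (forall (bN : compHausType) (e : nat -> bN), is_stone_cech R e ->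
     exists j : Ffun R alphaN -> Cfun R bN,
       (forall (f : Ffun R alphaN) (n : nat),
          funW (j f) (e n) = funW f (Some n)) /\
       is_V_minimum j) /\
  (forall K : compHausType,
     connected [set: K] -> (exists x y : K, x <> y) -> almostP R K ->
     ~ exists (A : wstarType R) (f : A -> Cfun R K), is_V_minimum f) /\
  (forall K : compHausType,
     basis [set U : set K | clopen U] -> almostP R K ->
     is_V_minimum (fun f : Ffun R K => F_incl f)).
Proof.
split; first exact: stone_cech_minimum.
split; first exact: connected_almostP_no_minimum.
exact: zero_dimensional_almostP_minimum.
Qed.
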